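(* Let $F=\frac1n\sum_{i=1}^nF_i$ with $F_i=\frac1m\sum_{j=1}^mF_{ij}$, and let $F$ be $\ell$-star-cocoercive. Assume that there are $\widehat\ell,\widetilde\ell>0$ such that for all $x\in\mathbb{R}^d$, with $x^*=\mathrm{proj}_{X^*}(x)$, $$\frac1n\sum_{i=1}^n\|F_i(x)-F_i(x^* )\|^2\le\widehat\ell\,\langle F(x)-F(x^* ),x-x^*\rangle,$$ $$\frac1{nm}\sum_{i=1}^n\sum_{j=1}^m\|F_{ij}(x)-F_{ij}(x^* )\|^2\le\widetilde\ell\,\langle F(x)-F(x^* ),x-x^*\rangle,$$ and that $X^*=\{x^*\}$ is a singleton. Suppose that $0<\alpha\le\min\left\{\frac p3,\frac1{1+\omega}\right\}$. Then VR-DIANA-SGDA satisfies the key parametric assumption with $$A=\frac\ell2+\frac{\widetilde\ell}{n}+\frac{\omega(\widehat\ell+\widetilde\ell)}{n},\quad B=\frac{2(\omega+1)}{n},\quad C=\frac{p\widetilde\ell}{2}+\alpha(\widetilde\ell+\widehat\ell),\quad\rho=\alpha,\quad D_1=D_2=0,$$ $$\sigma_k^2=\frac1n\sum_{i=1}^n\|h_i^k-F_i(x^* )\|^2+\frac1{nm}\sum_{i=1}^n\sum_{j=1}^m\|F_{ij}(w_i^k)-F_{ij}(x^* )\|^2.$$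
   Context: Norms and inner products on $\mathbb{R}^d$ are Euclidean. $F,F_i,F_{ij}:\mathbb{R}^d\to\mathbb{R}^d$ are operators and $R:\mathbb{R}^d\to\mathbb{R}\cup\{+\infty\}$ is a proper lower semicontinuous convex function. $X^*$ is the (nonempty) set of solutions of the regularized variational inequality: find $x^*\in\mathbb{R}^d$ with $\langle F(x^* ),x-x^*\rangle+R(x)-R(x^* )\ge0$ for all $x\in\mathbb{R}^d$. $\mathrm{proj}_{X^*}(x)=\arg\min_{y\in X^*}\|y-x\|$. $F$ is $\ell$-star-cocoercive ($\ell>0$) if $\|F(x)-F(x^* )\|^2\le\ell\langle F(x)-F(x^* ),x-x^*\rangle$ for all $x$, where $x^*=\mathrm{proj}_{X^*}(x)$. An unbiased compressor (quantization) with parameter $\omega\ge0$ is a possibly randomized map $\mathcal{Q}:\mathbb{R}^d\to\mathbb{R}^d$ with $\mathbb{E}[\mathcal{Q}(x)]=x$ and $\mathbb{E}\|\mathcal{Q}(x)-x\|^2\le\omega\|x\|^2$ for all $x$. VR-DIANA-SGDA, with $p\in(0,1]$, stepsizes $\gamma,\alpha>0$, such a $\mathcal{Q}$, starting points $x^0,h_i^0,w_i^0\in\mathbb{R}^d$, $h^0=\frac1n\sum_ih_i^0$: at iteration $k$, each $i=1,\dots,n$ draws $j_i^k$ uniformly from $\{1,\dots,m\}$ (freshly, independently across $i$) and sets $$g_i^k=F_{ij_i^k}(x^k)-F_{ij_i^k}(w_i^k)+F_i(w_i^k),$$ $w_i^{k+1}=x^k$ with probability $p$ and $w_i^{k+1}=w_i^k$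 with probability $1-p$, $\Delta_i^k=g_i^k-h_i^k$, $h_i^{k+1}=h_i^k+\alpha\mathcal{Q}(\Delta_i^k)$; then $$g^k=h^k+\frac1n\sum_{i=1}^n\mathcal{Q}(\Delta_i^k),\quad h^{k+1}=h^k+\frac\alpha n\sum_{i=1}^n\mathcal{Q}(\Delta_i^k)=\frac1n\sum_{i=1}^nh_i^{k+1},\quad x^{k+1}=\mathrm{prox}_{\gamma R}(x^k-\gamma g^k),$$ where $\mathrm{prox}_{\gamma R}(x)=\arg\min_{y}\{R(y)+\|y-x\|^2/(2\gamma)\}$. The compressions at different workers are independent, and the same realization of $\mathcal{Q}(\Delta_i^k)$ is used in all updates. Put $x^{*,k}=\mathrm{proj}_{X^*}(x^k)$ and $g^{*,k}=F(x^{*,k})$. $\mathbb{E}_k[\cdot]$ is the expectation with respect to the randomness at iteration $k$, i.e. conditional on everything generated before iteration $k$ (in particular on $x^k,h_i^k,w_i^k$). Key parametric assumption (with constants $A,B,C,D_1,D_2\ge0$, $\rho\in(0,1]$ and nonnegative variables $\sigma_k$): for all $k\ge0$, $\mathbb{E}_k[g^k]=F(x^k)$ and $$\mathbb{E}_k\|g^k-g^{*,k}\|^2\le2A\langle F(x^k)-g^{*,k},x^k-x^{*,k}\rangle+B\sigma_k^2+D_1,$$ $$\mathbb{E}_k[\sigma_{k+1}^2]\le2C\langle F(x^k)-g^{*,k},x^k-x^{*,k}\rangle+(1-\rho)\sigma_k^2+D_2.$$ *)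

(* Defs.v *)
From mathcomp Require Import all_boot all_order all_algebra.
From mathcomp Require Import all_classical all_reals all_analysis.

Set Implicit Arguments.
Unset Strict Implicit.
Unset Printing Implicit Defensive.

Import Order.TTheory GRing.Theory Num.Theory.
Import numFieldNormedType.Exports.

Local Open Scope classical_set_scope.
Local Open Scope ring_scope.

(* The norm [`|_|] of the library on ['rV[R]_d] is the max norm, hence the
   explicit Euclidean structure. *)
Definition dotv (R : realType) (d : nat) (u v : 'rV[R]_d) : R :=
  \sum_(c < d) u 0 c * v 0 c.

Definition enorm (R : realType) (d : nat) (u : 'rV[R]_d) : R :=
  Num.sqrt (dotv u u).

(* R^d with its Borel sigma-algebra. *)
Notation borel_vec R d := (g_sigma_algebraType (@open 'rV[R]_d)).

Definition mean_vec (R : realType) (d n : nat) (v : 'I_n -> 'rV[R]_d) :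
    'rV[R]_d :=
  n%:R^-1 *: \sum_(i < n) v i.

Definition argmin (R : realType) (d : nat) (disp : Order.disp_t)
    (T : porderType disp) (f : 'rV[R]_d -> T) (S : set 'rV[R]_d) : 'rV[R]_d :=
  xget 0 [set y | S y /\ forall z, S z -> (f y <= f z)%O].

Definition proj_set (R : realType) (d : nat) (S : set 'rV[R]_d) (x : 'rV[R]_d) :
    'rV[R]_d :=
  argmin (fun y => enorm (y - x)) S.

Definition prox (R : realType) (d : nat) (gamma : R) (Reg : 'rV[R]_d -> \bar R)
    (x : 'rV[R]_d) : 'rV[R]_d :=
  argmin (fun y => (Reg y + (enorm (y - x) ^+ 2 / (2 * gamma))%:E)%E) setT.

Definition proper_ereal (R : realType) (d : nat) (Reg : 'rV[R]_d -> \bar R) : Prop :=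
  (forall x, Reg x != -oo%E) /\ (exists x, Reg x != +oo%E).

Definition convex_ereal (R : realType) (d : nat) (Reg : 'rV[R]_d -> \bar R) :
    Prop :=
  forall (x y : 'rV[R]_d) (t : R), 0 < t -> t < 1 ->
    (Reg (t *: x + (1 - t) *: y)%R <= t%:E * Reg x + (1 - t)%R%:E * Reg y)%E.

(* As [+oo - +oo = -oo] in [\bar R], a point where [Reg] is [+oo] is never a
   solution (take for [x] the point itself). *)
Definition vi_solutions (R : realType) (d : nat) (F : 'rV[R]_d -> 'rV[R]_d)
    (Reg : 'rV[R]_d -> \bar R) : set 'rV[R]_d :=
  [set xs | forall x : 'rV[R]_d,
    (0 <= (dotv (F xs) (x - xs)%R)%:E + Reg x - Reg xs)%E].

Definition star_cocoercive (R : realType) (d : nat) (ell : R)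
    (F : 'rV[R]_d -> 'rV[R]_d) (Xs : set 'rV[R]_d) : Prop :=
  forall x, let xs := proj_set Xs x in
    enorm (F x - F xs) ^+ 2 <= ell * dotv (F x - F xs) (x - xs).

(* The randomized map is [x |-> Q x t], where the seed [t] has law [nu]. *)
Definition unbiased_compressor (R : realType) (d : nat) (dX : measure_display)
    (Xi : measurableType dX) (nu : probability Xi R)
    (Q : 'rV[R]_d -> Xi -> 'rV[R]_d) (omega : R) : Prop :=
  [/\ measurable_fun [set: borel_vec R d * Xi]
        (fun z => Q z.1 z.2 : borel_vec R d),
      forall x c, (\int[nu]_t (Q x t 0 c)%:E = (x 0 c)%:E)%E
    & forall x, (\int[nu]_t (enorm (Q x t - x) ^+ 2)%:E
                 <= (omega * enorm x ^+ 2)%:E)%E].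

Section ConditionalExpectation.
Context (R : realType) (dO : measure_display) (Omega : measurableType dO).
Variables (P : probability Omega R) (G : set (set Omega)).

Definition measurable_wrt (Y : Omega -> R) : Prop :=
  forall B : set R, measurable B -> G (Y @^-1` B).

(* [Y] is a (finite) version of the conditional expectation of [X >= 0] given
   the sigma-algebra [G]; [X] need not be integrable. *)
Definition is_cexp_nneg (X Y : Omega -> R) : Prop :=
  [/\ measurable_fun setT X /\ (forall o, 0 <= X o),
      measurable_wrt Y /\ (forall o, 0 <= Y o)
    & forall A, G A ->
        (\int[P]_(o in A) (X o)%:E = \int[P]_(o in A) (Y o)%:E)%E].

(* E[X | G] = E[X^+ | G] - E[X^- | G], both terms being finite. *)
Definition is_cexp (X Y : Omega -> R) : Prop :=
  exists Yp Yn : Omega -> R,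
    [/\ is_cexp_nneg X^\+ Yp, is_cexp_nneg X^\- Yn
      & forall o, Y o = Yp o - Yn o].

Definition is_cexp_vec (d : nat) (X Y : Omega -> 'rV[R]_d) : Prop :=
  forall c, is_cexp (fun o => X o 0 c) (fun o => Y o 0 c).

(* E[X | G] <= Z almost surely, for X >= 0; since two versions of E[X | G] agree
   almost surely, it does not matter which one is used. *)
Definition cexp_nneg_le (X Z : Omega -> R) : Prop :=
  exists2 Y, is_cexp_nneg X Y & {ae P, forall o, Y o <= Z o}.

End ConditionalExpectation.

Definition key_parametric_assumption (R : realType) (d : nat)
    (dO : measure_display) (Omega : measurableType dO) (P : probability Omega R)
    (past : nat -> set (set Omega))
    (F : 'rV[R]_d -> 'rV[R]_d) (Xs : set 'rV[R]_d)
    (x g : nat -> Omega -> 'rV[R]_d)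
    (A B C D1 D2 rho : R) (sigma : nat -> Omega -> R) : Prop :=
  let xs k o := proj_set Xs (x k o) in
  let gs k o := F (xs k o) in
  let gap k o := dotv (F (x k o) - gs k o) (x k o - xs k o) in
  [/\ [/\ 0 <= A, 0 <= B, 0 <= C, 0 <= D1 & 0 <= D2],
      0 < rho <= 1,
      forall k o, 0 <= sigma k o
    & forall k,
      [/\ is_cexp_vec P (past k) (g k) (fun o => F (x k o)),
          cexp_nneg_le P (past k)
            (fun o => enorm (g k o - gs k o) ^+ 2)
            (fun o => 2 * A * gap k o + B * sigma k o ^+ 2 + D1)
        & cexp_nneg_le P (past k)
            (fun o => sigma k.+1 o ^+ 2)
            (fun o => 2 * C * gap k o + (1 - rho) * sigma k o ^+ 2 + D2)]].

Section VRDianaSGDA.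
Context (R : realType) (d n m : nat).
Context (dO : measure_display) (Omega : measurableType dO).
Context (dX : measure_display) (Xi : measurableType dX).

Definition worker_op (Fij : 'I_n -> 'I_m -> 'rV[R]_d -> 'rV[R]_d) (i : 'I_n)
    (x : 'rV[R]_d) : 'rV[R]_d :=
  mean_vec (fun j => Fij i j x).

Definition mean_op (Fij : 'I_n -> 'I_m -> 'rV[R]_d -> 'rV[R]_d)
    (x : 'rV[R]_d) : 'rV[R]_d :=
  mean_vec (fun i => worker_op Fij i x).

(* [vr_hm] is the master sequence h^k and [vr_h] the workers' h_i^k. In iteration
   k worker i uses the index [vr_j], the coin [vr_coin] (true: refresh w_i) and
   the seed [vr_xi] of its compressor. *)
Record vr_process := VRProcess {
  vr_x : nat -> Omega -> 'rV[R]_d;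
  vr_hm : nat -> Omega -> 'rV[R]_d;
  vr_h : nat -> 'I_n -> Omega -> 'rV[R]_d;
  vr_w : nat -> 'I_n -> Omega -> 'rV[R]_d;
  vr_j : nat -> 'I_n -> Omega -> 'I_m;
  vr_coin : nat -> 'I_n -> Omega -> bool;
  vr_xi : nat -> 'I_n -> Omega -> Xi
}.

Variables (Fij : 'I_n -> 'I_m -> 'rV[R]_d -> 'rV[R]_d).
Variables (Q : 'rV[R]_d -> Xi -> 'rV[R]_d).
Variables (s : vr_process).

Definition vr_gi (k : nat) (i : 'I_n) (o : Omega) : 'rV[R]_d :=
  Fij i (vr_j s k i o) (vr_x s k o) - Fij i (vr_j s k i o) (vr_w s k i o)
  + worker_op Fij i (vr_w s k i o).

Definition vr_Delta (k : nat) (i : 'I_n) (o : Omega) : 'rV[R]_d :=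
  vr_gi k i o - vr_h s k i o.

Definition vr_QDelta (k : nat) (i : 'I_n) (o : Omega) : 'rV[R]_d :=
  Q (vr_Delta k i o) (vr_xi s k i o).

Definition vr_g (k : nat) (o : Omega) : 'rV[R]_d :=
  vr_hm s k o + mean_vec (fun i => vr_QDelta k i o).

Definition past_gen (k : nat) : set (set Omega) :=
  [set A | exists2 l, (l <= k)%N & exists2 B : set (borel_vec R d),
     measurable B &
     [\/ A = vr_x s l @^-1` B, A = vr_hm s l @^-1` B |
         exists i, A = vr_h s l i @^-1` B \/ A = vr_w s l i @^-1` B]]
  `|`
  [set A | exists2 l, (l < k)%N & exists i,
     [\/ exists j, A = [set o | vr_j s l i o = j],
         A = [set o | vr_coin s l i o] |
         exists2 B : set Xi, measurable B & A = vr_xi s l i @^-1` B]].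

(* The sigma-algebra of everything generated before iteration k. *)
Definition past (k : nat) : set (set Omega) := <<s past_gen k >>.

(* Conditionally on the past, the indices are uniform, the seeds have law [nu]
   and all of these are independent; each coin has success probability [p] (the
   joint law of the coins with the other variables of the iteration is left
   free). *)
Definition fresh_randomness (P : probability Omega R) (nu : probability Xi R)
    (p : R) (k : nat) : Prop :=
  (forall A (J : 'I_n -> 'I_m) (B : 'I_n -> set Xi), past k A ->
     (forall i, measurable (B i)) ->
     P (A `&` [set o | forall i, vr_j s k i o = J i /\ B i (vr_xi s k i o)])
     = (P A * \prod_(i < n) ((m%:R^-1)%:E * nu (B i)))%E) /\
  (forall A i, past k A ->
     P (A `&` [set o | vr_coin s k i o]) = (P A * p%:E)%E).

(* The first clause says that the iterates, indices, coins and seeds are random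
   variables on [Omega]. *)
Definition vr_diana_sgda (P : probability Omega R) (nu : probability Xi R)
    (Reg : 'rV[R]_d -> \bar R) (p gamma alpha : R)
    (x0 : 'rV[R]_d) (h0 w0 : 'I_n -> 'rV[R]_d) : Prop :=
  [/\ forall k A, past_gen k A -> measurable A,
      forall k, fresh_randomness P nu p k,
      forall o, [/\ vr_x s 0 o = x0, vr_hm s 0 o = mean_vec h0,
                    forall i, vr_h s 0 i o = h0 i
                  & forall i, vr_w s 0 i o = w0 i]
    & forall k o,
      [/\ vr_x s k.+1 o = prox gamma Reg (vr_x s k o - gamma *: vr_g k o),
          vr_hm s k.+1 o =
            vr_hm s k o + alpha *: mean_vec (fun i => vr_QDelta k i o),
          forall i, vr_h s k.+1 i o = vr_h s k i o + alpha *: vr_QDelta k i o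
        & forall i, vr_w s k.+1 i o =
            if vr_coin s k i o then vr_x s k o else vr_w s k i o]].

End VRDianaSGDA.

(* Main.v *)
Require Import Defs.
From mathcomp Require Import all_boot all_order all_algebra.
From mathcomp Require Import all_classical all_reals all_analysis.
From HB Require Import structures.
From mathcomp Require Import measurable_realfun ring lra.

(** Conditionally on the past, iteration [k] is an experiment with a frozen
    state [(x, h_i, w_i)] and independent pairs (index, seed), one per worker.
    Hence a conditional expectation is an ordinary expectation over a fresh copy
    of the noise, integrated against the frozen state (Fubini).

    For the frozen state, with [Delta_i] the vector compressed by worker [i]:
    - [g] has mean [F x], and by independence [E |g - F xs|^2] is
      [|F x - F xs|^2] plus [n^-2] times the sum of the workers' variances, each
      at most [Var g_i + omega E |Delta_i|^2];
    - [Var g_i <= E |F_ij x - F_ij w_i|^2], and inserting [F_ij xs] and [F_i xs]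
      bounds everything by the gap and the two parts of [sigma^2];
    - [alpha (1 + omega) <= 1] absorbs the compression error of the shift:
      [E |h_i' - F_i xs|^2 <= (1 - alpha) |h_i - F_i xs|^2
        + alpha |F_i x - F_i xs|^2 + alpha Var g_i];
    - the coin refreshes the second part of [sigma^2] with probability [p]; the
      [2 alpha] coming from [Var g_i] is paid for by [3 alpha <= p]. *)

Set Implicit Arguments.
Unset Strict Implicit.
Unset Printing Implicit Defensive.

Import Order.TTheory GRing.Theory Num.Theory.
Import numFieldNormedType.Exports.

Local Open Scope classical_set_scope.
Local Open Scope ring_scope.

(** * Borel measurability in R^d *)

Lemma measurable_coord (R : realType) (d : nat) (c : 'I_d) :
  measurable_fun [set: borel_vec R d]
    (fun v : borel_vec R d => (v : 'rV[R]_d) 0 c).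
Proof.
apply: (measurability _ (RGenOpens.measurableE R)).
move=> _ [_ [a [b ->] <-]]; rewrite setTI; apply: sub_sigma_algebra.
have /continuousP := @coord_continuous R 1 d 0 c.
by apply; exact: interval_open.
Qed.

(* An open set is a countable union of boxes with rational centres. *)
Lemma measurable_vec (R : realType) (d : nat) (dT : measure_display)
    (T : measurableType dT) (f : T -> 'rV[R]_d) :
  (forall c, measurable_fun setT (fun t => f t 0 c)) ->
  measurable_fun setT (f : T -> borel_vec R d).
Proof.
move=> mf.
apply: (@measurability _ _ T (borel_vec R d) setT f (@open 'rV[R]_d)) => //.
move=> _ [U oU <-]; rewrite setTI.
pose box (q : 'rV[rat]_d) (k : nat) : set 'rV[R]_d :=
  [set v | forall c, `|v 0 c - ratr (q 0 c)| < k.+1%:R^-1].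
(* The codes of pairs (rational centre, radius index) enumerate the boxes. A box that leaves [U]
   contributes [set0], so the union of the cells lies in the preimage of [U] by construction. *)
pose cell (a : nat) : set T :=
  if @unpickle ('rV[rat]_d * nat)%type a is Some qk then
    if `[< box qk.1 qk.2 `<=` U >] then f @^-1` box qk.1 qk.2 else set0
  else set0.
have mcell a : measurable (cell a).
  rewrite /cell; case: unpickle => [[q k]|] //=.
  case: asboolP => // _.
  rewrite (_ : _ @^-1` _ = \bigcap_(c in [set: 'I_d])
      ((fun t => `|f t 0 c - ratr (q 0 c)|) @^-1` `]-oo, k.+1%:R^-1[%classic)).
    apply: fin_bigcap_measurable => //.
    move=> c _; rewrite -[X in measurable X]setTI.
    suff /(_ measurableT) : measurable_fun setT (fun t => `|f t 0 c - ratr (q 0 c)|).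
      by apply; exact: measurable_itv.
    by apply: measurableT_comp => //; exact: measurable_funB.
  apply/seteqP; split => t /=.
    by move=> h c _ /=; rewrite in_itv/=; exact: h.
  by move=> h c; have := h c Logic.I; rewrite /= in_itv.
suff -> : f @^-1` U = \bigcup_a cell a by exact: bigcupT_measurable.
apply/seteqP; split => t; last first.
  move=> [a _]; rewrite /cell; case: unpickle => [[q k]|] //=.
  by case: asboolP => // + ft; apply.
move=> /= Uft.
have /nbhs_ballP[e/= e0 eU] : nbhs (f t) U by exact: open_nbhs_nbhs.
(* The radius is below [e / 2]: a centre this close to [f t] has its whole box inside the max-norm
   ball of radius [e] around [f t]. *)
have [k] := ltr_add_invr (divr_gt0 e0 (ltr0Sn _ 1)); rewrite add0r => ke.
have qex (c : 'I_d) : exists q : rat, `|f t 0 c - ratr q| < k.+1%:R^-1.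
  have k0 : (0 : R) < k.+1%:R^-1 by rewrite invr_gt0 ltr0n.
  have /rat_in_itvoo[q] : f t 0 c - k.+1%:R^-1 < f t 0 c + k.+1%:R^-1.
    by rewrite ltrBlDr -addrA ltrDl addr_gt0.
  rewrite in_itv/= => /andP[h1 h2]; exists q.
  rewrite distrC ltr_distlC; apply/andP.
  by split; rewrite ?(ltrBlDr, ltrBrDr)// -ltrBlDr.
pose q : 'rV[rat]_d := \row_c projT1 (cid (qex c)).
have qP c : `|f t 0 c - ratr (q 0 c)| < k.+1%:R^-1.
  by rewrite mxE; exact: (projT2 (cid (qex c))).
exists (pickle (q, k)) => //; rewrite /cell pickleK /=.
case: asboolP => [_ //|]; case => v vb; apply: eU; split => [|i c] //.
rewrite ord1 /ball/= (le_lt_trans (ler_distD (ratr (q 0 c)) _ _))//.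
rewrite [e]splitr ltrD// (lt_trans _ ke)//.
by rewrite distrC; exact: vb.
Qed.

(** * Independence and freezing *)

(** As functions of [B], both sides are finite measures: [P] restricted to [A] and [P] scaled by
    [P A]. They agree on the pi-system [H] and on the whole space, hence on the generated
    sigma-algebra. *)
Lemma indep_g_sigma_algebra (R : realType) (dO : measure_display)
    (Omega : measurableType dO) (P : probability Omega R)
    (A : set Omega) (H : set (set Omega)) :
  measurable A -> H `<=` measurable -> setI_closed H ->
  (forall B, H B -> P (A `&` B) = (P A * P B)%E) ->
  forall B, <<s H >> B -> P (A `&` B) = (P A * P B)%E.
Proof.
move=> mA mH IH indH B HB.
pose r : {nonneg R} := NngNum (fine_ge0 (measure_ge0 P A)).
have rE : r%:num%:E = P A by rewrite /= fineK// fin_num_measure.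
have KE (X : set Omega) : mscale r P X = (P A * P X)%E by rewrite -rE.
have KA (X : set Omega) : mrestr P mA X = P (A `&` X) by rewrite setIC.
rewrite -KA -KE.
apply: (g_sigma_algebra_measure_unique_trace H setT) => //.
- by move=> X [/mH].
- by move=> X Y [HX _] [HY _]; split => //; exact: IH.
- by rewrite /= KA KE setIT probability_setT mule1.
- by move=> X [HX _]; rewrite /= KA KE indH.
- by rewrite /= KA setIT -ge0_fin_numE// fin_num_measure.
- rewrite (_ : [set X | _] = H)//.
  by apply/seteqP; split => X; [case|move=> HX; split].
Qed.

(** Independence makes the joint law of [(X, Y)] the product of the marginal laws, and Tonelli turns
    the integral against it into an iterated one. *)
Lemma ge0_integral_indep (R : realType) (dO d1 d2 : measure_display)
    (Omega : measurableType dO) (P : probability Omega R)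
    (T1 : measurableType d1) (T2 : measurableType d2)
    (X : Omega -> T1) (Y : Omega -> T2) (f : T1 * T2 -> \bar R) :
  measurable_fun setT X -> measurable_fun setT Y ->
  (forall A B, measurable A -> measurable B ->
     P (X @^-1` A `&` Y @^-1` B) = (P (X @^-1` A) * P (Y @^-1` B))%E) ->
  measurable_fun setT f -> (forall z, 0 <= f z)%E ->
  (\int[P]_o f (X o, Y o) = \int[P]_o \int[P]_o' f (X o, Y o'))%E.
Proof.
move=> mX mY ind mf f0.
pose mfX : {mfun Omega >-> T1} := HB.pack X (isMeasurableFun.Build _ _ _ _ _ mX).
pose mfY : {mfun Omega >-> T2} := HB.pack Y (isMeasurableFun.Build _ _ _ _ _ mY).
have mXY : measurable_fun setT (fun o => (X o, Y o)) by exact: measurable_fun_pair.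
pose mfXY : {mfun Omega >-> (T1 * T2)%type} :=
  HB.pack (fun o => (X o, Y o)) (isMeasurableFun.Build _ _ _ _ _ mXY).
transitivity (\int[distribution P mfXY]_z f z)%E.
  by rewrite ge0_integral_distribution.
(* A product measure is determined by its values on rectangles, where the independence hypothesis
   applies. *)
rewrite (eq_measure_integral (distribution P mfX \x distribution P mfY)%E); last first.
  move=> A mA _; apply/esym.
  by apply: product_measure_unique => // {mA}A B mA mB; exact: ind.
rewrite fubini_tonelli1// ge0_integral_distribution//; last 2 first.
- exact: measurable_fun_fubini_tonelli_F.
- by move=> x; exact: integral_ge0.
apply: eq_integral => o _ /=; rewrite /fubini_F ge0_integral_distribution//.
exact: measurableT_comp.
Qed.

Lemma g_sigma_algebraT (T : pointedType) (G : set (set T)) : <<s G >> setT.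
Proof.
by rewrite -[X in _ X]setC0; apply: sigma_algebraC; exact: sigma_algebra0.
Qed.

Lemma g_sigma_algebra_sub_measurable (dO : measure_display)
    (Omega : measurableType dO) (G : set (set Omega)) :
  G `<=` measurable -> <<s G >> `<=` measurable.
Proof. by move=> mG; apply: smallest_sub => //; exact: sigma_algebra_measurable. Qed.

Lemma measurable_id_g_sigma (dO : measure_display)
    (Omega : measurableType dO) (G : set (set Omega)) :
  G `<=` measurable ->
  measurable_fun setT (id : Omega -> g_sigma_algebraType G).
Proof.
by move=> mG _ B mB; rewrite setTI; exact: (g_sigma_algebra_sub_measurable mG).
Qed.

(* [OG] and [OH] are [Omega] itself with the sub-sigma-algebras generated by [G]
   and [H]; the state and the noise are both the identity map of [Omega]. *)
Section freezing.
Context (R : realType) (dO : measure_display) (Omega : measurableType dO).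
Variables (P : probability Omega R) (G H : set (set Omega)).
Hypotheses (mG : G `<=` measurable) (mH : H `<=` measurable) (HI : setI_closed H).
Hypothesis ind : forall A B, <<s G >> A -> H B -> P (A `&` B) = (P A * P B)%E.
Local Notation OG := (g_sigma_algebraType G).
Local Notation OH := (g_sigma_algebraType H).

(** The two occurrences of the outcome in [f o o] are decoupled: the first is the state, the second
    the noise. Independence is known on the generators [H] only and is first extended to
    [<<s H>>]. *)
Lemma ge0_integral_freeze (f : Omega -> Omega -> \bar R) :
  measurable_fun [set: OG * OH] (fun z => f z.1 z.2) ->
  (forall o o', 0 <= f o o')%E ->
  (\int[P]_o f o o = \int[P]_o \int[P]_o' f o o')%E.
Proof.
move=> mf f0.
apply: (@ge0_integral_indep R dO _ _ Omega P OG OH id id (fun z => f z.1 z.2)) => //.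
- exact: measurable_id_g_sigma.
- exact: measurable_id_g_sigma.
- move=> A B mA mB; apply: (indep_g_sigma_algebra _ mH HI) => //.
    exact: (g_sigma_algebra_sub_measurable mG).
  by move=> B' HB'; exact: ind.
Qed.

(** The partial integral is measurable in the state by Tonelli; freezing [f] multiplied by the
    indicator of an event of the past gives the defining identity of the conditional expectation. *)
Lemma is_cexp_nneg_freeze (f : Omega -> Omega -> R) (Y : Omega -> R) :
  measurable_fun [set: OG * OH] (fun z => f z.1 z.2) ->
  (forall o o', 0 <= f o o') ->
  (forall o, \int[P]_o' (f o o')%:E = (Y o)%:E)%E ->
  is_cexp_nneg P <<s G >> (fun o => f o o) Y.
Proof.
move=> mf f0 fY.
have midG := measurable_id_g_sigma mG.
have midH := measurable_id_g_sigma mH.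
split; [split => //|split|].
- have midGH : measurable_fun setT (fun o : Omega => ((o, o) : OG * OH)).
    exact: measurable_fun_pair.
  exact: (measurableT_comp mf midGH).
- have mY : measurable_fun [set: OG] Y.
    apply/measurable_EFinP.
    pose idH : {mfun Omega >-> OH} := HB.pack (id : Omega -> OH)
      (isMeasurableFun.Build _ _ _ _ _ midH).
    have mfE : measurable_fun [set: OG * OH] (fun z => (f z.1 z.2)%:E).
      exact/measurable_EFinP.
    have : measurable_fun [set: OG]
        (fubini_F (distribution P idH) (fun z : OG * OH => (f z.1 z.2)%:E)).
      by apply: measurable_fun_fubini_tonelli_F => // z; rewrite lee_fin.
    congr (measurable_fun _ _); apply/funext => o; rewrite /fubini_F /= -fY.
    rewrite ge0_integral_distribution// => [|y]; last by rewrite lee_fin.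
    exact: (measurableT_comp mfE (measurable_pair1 o)).
  by move=> B mB; have := mY measurableT B mB; rewrite setTI.
- by move=> o; rewrite -lee_fin -fY; apply: integral_ge0 => o' _; rewrite lee_fin.
- move=> A GA.
  have mA := g_sigma_algebra_sub_measurable mG GA.
  pose g o o' := ((f o o' * \1_A o)%R)%:E.
  transitivity (\int[P]_o g o o)%E.
    rewrite integral_mkcond; apply: eq_integral => o _.
    by rewrite patchE /g indicE; case: (o \in A); rewrite ?mulr1 ?mulr0.
  rewrite ge0_integral_freeze.
  - rewrite [RHS]integral_mkcond; apply: eq_integral => o _.
    rewrite patchE /g indicE; case: (o \in A).
      by rewrite -fY; under eq_integral do rewrite mulr1.
    by under eq_integral do rewrite mulr0; rewrite integral0.
  - apply/measurable_EFinP; apply: measurable_funM => //.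
    by apply: (measurableT_comp (f := \1_A : OG -> R)) => //; exact: measurable_indic.
  - by move=> o o'; rewrite lee_fin mulr_ge0.
Qed.

End freezing.

(** * Finite partitions and restricted measures *)

Lemma measure_fin_partition (R : realType) (dO : measure_display)
    (Omega : measurableType dO) (mu : {measure set Omega -> \bar R})
    (I : finType) (J : Omega -> I) (A : set Omega) :
  measurable A -> (forall i, measurable (J @^-1` [set i])) ->
  (mu A = \sum_i mu (A `&` J @^-1` [set i]))%E.
Proof.
move=> mA mJ.
have AE : A = \bigcup_(i in [set: I]) (A `&` J @^-1` [set i]).
  by apply/seteqP; split => o; [exists (J o)|case=> i _ []].
have tJ : trivIset [set: I] (fun i => A `&` J @^-1` [set i]).
  by move=> i1 i2 _ _ [w [[_ <-] [_ <-]]].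
have mAJ i : [set: I] i -> measurable (A `&` J @^-1` [set i]).
  by move=> _; exact: measurableI.
rewrite {1}AE (measure_fin_bigcup mu finite_finset tJ mAJ).
rewrite (@fsbigE _ _ _ _ _ (index_enum I))//.
- by apply: eq_bigl => i; rewrite in_setT.
- exact: index_enum_uniq.
- by move=> i _; rewrite mem_index_enum.
Qed.

(** Handles the random index: [I] is a bare finite type, so the measurability of [J] is expressed
    through its fibres. *)
Lemma measurable_fun_fin_choice (d1 d2 : measure_display) (T1 : measurableType d1)
    (T2 : measurableType d2) (I : finType) (J : T1 -> I) (F : I -> T1 -> T2) :
  (forall i, measurable (J @^-1` [set i])) ->
  (forall i, measurable_fun setT (F i)) ->
  measurable_fun setT (fun t => F (J t) t).
Proof.
move=> mJ mF _ B mB; rewrite setTI.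
rewrite (_ : _ @^-1` B =
    \bigcup_(i in [set: I]) (J @^-1` [set i] `&` F i @^-1` B)).
  apply: fin_bigcup_measurable => // i _; apply: measurableI => //.
  by rewrite -[X in measurable X]setTI; exact: mF.
by apply/seteqP; split => [t Bt|t [i _ [/= <-]]//]; exists (J t).
Qed.

Lemma ge0_integral_mrestr (R : realType) (dT : measure_display)
    (T : measurableType dT) (mu : {measure set T -> \bar R}) (D : set T)
    (mD : measurable D) (f : T -> \bar R) :
  measurable_fun setT f -> (forall t, 0 <= f t)%E ->
  (\int[mrestr mu mD]_t f t = \int[mu]_(t in D) f t)%E.
Proof.
move=> mf f0.
rewrite (@eq_measure_integral _ _ _ _ (mrestr mu mD) mu); last first.
  by move=> A mA AD; rewrite /mrestr; congr (mu _); apply/esym/setIidPl.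
have mDC := measurableC mD.
have dD : [disjoint D & ~` D] by apply/disj_setPS => t [].
rewrite -{1}(setUv D) (ge0_integral_setU _ mD mDC)//; last by rewrite setUv.
rewrite [X in (_ + X)%E](_ : _ = 0%E) ?adde0//.
apply: null_set_integral => //.
- exact: measurable_funTS.
- by rewrite /= /mrestr setICl measure0.
Qed.

(** * Second moments *)

Section second_moments.
Context (R : realType) (dT : measure_display) (T : measurableType dT).
Variable P : probability T R.

Lemma integral_cst_probability (r : R) : (\int[P]_t r%:E = r%:E)%E.
Proof.
by rewrite [LHS](integral_cst P measurableT r%:E) [X in (_ * X)%E]probability_setT
  mule1.
Qed.

Lemma integrable_ge0_fin (phi : T -> R) (s : R) : measurable_fun setT phi ->
  (forall t, 0 <= phi t) -> (\int[P]_t (phi t)%:E = s%:E)%E ->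
  P.-integrable setT (EFin \o phi).
Proof.
move=> mphi phi0 phis; apply/integrableP; split; first exact/measurable_EFinP.
under eq_integral do rewrite gee0_abs ?lee_fin//.
by rewrite phis ltry.
Qed.

(** A probability measure integrates constants, and the absolute value of [phi] is at most
    [1 + phi ^+ 2]. *)
Lemma integrable_sqr (phi : T -> R) : measurable_fun setT phi ->
  (\int[P]_t (phi t ^+ 2)%:E < +oo)%E -> P.-integrable setT (EFin \o phi).
Proof.
move=> mphi phi2.
have iphi2 : P.-integrable setT (fun t => (phi t ^+ 2)%:E).
  apply/integrableP; split.
    by apply/measurable_EFinP; exact: measurable_funX.
  by under eq_integral do rewrite gee0_abs ?lee_fin ?sqr_ge0//.
apply: (le_integrable measurableT _ _
  (integrableD measurableT (finite_measure_integrable_cst P 1 measurableT) iphi2)).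
  exact/measurable_EFinP.
move=> t _ /=; rewrite lee_fin [leRHS]ger0_norm ?addr_ge0 ?sqr_ge0//.
by rewrite -[in leRHS]real_normK ?num_real//; nra.
Qed.

(** Expansion of the square. It is applied to centred [phi], with [e = 0], where it becomes the
    bias-variance identity. *)
Lemma integral_sqr_shift (phi : T -> R) (a e s : R) : measurable_fun setT phi ->
  (\int[P]_t (phi t)%:E = e%:E)%E -> (\int[P]_t (phi t ^+ 2)%:E = s%:E)%E ->
  (\int[P]_t ((a + phi t) ^+ 2)%:E = (a ^+ 2 + 2 * a * e + s)%:E)%E.
Proof.
move=> mphi phie phi2.
have iphi : P.-integrable setT (EFin \o phi).
  by apply: integrable_sqr => //; rewrite phi2 ltry.
have iphi2 : P.-integrable setT (fun t => (phi t ^+ 2)%:E).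
  apply: (integrable_ge0_fin _ _ phi2) => [|t]; last exact: sqr_ge0.
  exact: measurable_funX.
have icst : P.-integrable setT (EFin \o cst (a ^+ 2)).
  exact: finite_measure_integrable_cst.
have iZ := integrableZl measurableT (2 * a) iphi.
transitivity (\int[P]_t (((EFin \o cst (a ^+ 2)%R) t
    + (2 * a)%R%:E * (EFin \o phi) t) + (phi t ^+ 2)%:E))%E.
  apply: eq_integral => t _ /=; rewrite -EFinM -!EFinD; congr (_%:E).
  by ring.
rewrite integralD//; last exact: integrableD.
by rewrite integralD// integralZl// phi2 phie integral_cst_probability -EFinM -!EFinD.
Qed.

Lemma integral_affine (phi : T -> R) (a b e : R) :
  P.-integrable setT (EFin \o phi) -> (\int[P]_t (phi t)%:E = e%:E)%E ->
  P.-integrable setT (fun t => (b + a * phi t)%:E) /\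
  (\int[P]_t (b + a * phi t)%R%:E = (b + a * e)%R%:E)%E.
Proof.
move=> iphi phie.
have icst : P.-integrable setT (EFin \o cst b) by exact: finite_measure_integrable_cst.
have iZ := integrableZl measurableT a iphi.
have E : (fun t => (b + a * phi t)%:E) =
    ((EFin \o cst b) \+ (fun x => a%:E * (EFin \o phi) x))%E.
  by apply/funext => t /=; rewrite EFinD EFinM.
split; first by rewrite E; exact: integrableD.
by rewrite E integralD// integralZl// phie integral_cst_probability -EFinM -EFinD.
Qed.

End second_moments.

Lemma sqr_enorm (R : realType) (d : nat) (u : 'rV[R]_d) :
  enorm u ^+ 2 = \sum_(c < d) u 0 c ^+ 2.
Proof.
rewrite /enorm sqr_sqrtr; first by apply: eq_bigr => c _; rewrite expr2.
by apply: sumr_ge0 => c _; rewrite -expr2 sqr_ge0.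
Qed.

Lemma mean_vecE (R : realType) (d n : nat) (v : 'I_n -> 'rV[R]_d) c :
  mean_vec v 0 c = n%:R^-1 * \sum_i v i 0 c.
Proof. by rewrite /mean_vec mxE summxE. Qed.

(** * Moments of the compressor, coordinate by coordinate *)

Section compressor.
Context (R : realType) (d : nat) (dX : measure_display) (Xi : measurableType dX).
Variables (nu : probability Xi R) (Q : 'rV[R]_d -> Xi -> 'rV[R]_d) (omega : R).
Hypothesis hQ : unbiased_compressor nu Q omega.

(** The variance of one coordinate of the compressed vector; [fine] loses nothing, since
    [compressor_varE] shows the integral to be finite. *)
Definition compressor_var (v : 'rV[R]_d) (c : 'I_d) : R :=
  fine (\int[nu]_t ((Q v t 0 c - v 0 c) ^+ 2)%:E).

Lemma measurable_compressor v c : measurable_fun setT (fun t => Q v t 0 c).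
Proof.
case: hQ => mQ _ _.
have mp : measurable_fun setT (fun t : Xi => ((v, t) : borel_vec R d * Xi)).
  exact: pair1_measurable.
exact: (measurableT_comp (measurable_coord c) (measurableT_comp mQ mp)).
Qed.

Let mdiff v c : measurable_fun setT (fun t => Q v t 0 c - v 0 c).
Proof. by apply: measurable_funB => //; exact: measurable_compressor. Qed.

Let msqr v c : measurable_fun setT (fun t => ((Q v t 0 c - v 0 c) ^+ 2)%:E).
Proof. by apply/measurable_EFinP; exact: measurable_funX. Qed.

Let var_sum v : (\sum_c \int[nu]_t ((Q v t 0 c - v 0 c) ^+ 2)%:E
   <= (omega * enorm v ^+ 2)%:E)%E.
Proof.
case: hQ => _ _ /(_ v); apply: le_trans.
rewrite -ge0_integral_sum//; last by move=> c t _; rewrite lee_fin sqr_ge0.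
rewrite le_eqVlt; apply/orP; left; apply/eqP; apply: eq_integral => t _.
by rewrite sqr_enorm sumEFin; congr _%:E; apply: eq_bigr => c _; rewrite !mxE.
Qed.

(** Each coordinate variance is dominated by the sum over all coordinates, which [omega] bounds by a
    real number. *)
Lemma compressor_varE v c :
  (\int[nu]_t ((Q v t 0 c - v 0 c) ^+ 2)%:E = (compressor_var v c)%:E)%E.
Proof.
have i0 c' : (0 <= \int[nu]_t ((Q v t 0 c' - v 0 c') ^+ 2)%:E)%E.
  by apply: integral_ge0 => t _; rewrite lee_fin sqr_ge0.
rewrite fineK// ge0_fin_numE//.
apply: (le_lt_trans _ (ltry (omega * enorm v ^+ 2))).
apply: le_trans (var_sum v).
by rewrite (bigD1 c)//= leeDl// sume_ge0.
Qed.

Lemma compressor_var_le v :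
  \sum_c compressor_var v c <= omega * enorm v ^+ 2.
Proof.
rewrite -lee_fin -sumEFin; apply: le_trans (var_sum v).
by under eq_bigr do rewrite -compressor_varE.
Qed.

Lemma compressor_affine v c (a b : R) :
  nu.-integrable setT (fun t => (b + a * Q v t 0 c)%:E) /\
  (\int[nu]_t (b + a * Q v t 0 c)%R%:E = (b + a * v 0 c)%R%:E)%E.
Proof.
apply: integral_affine; last by case: hQ => _ + _; exact.
have isq : nu.-integrable setT (EFin \o (fun t => Q v t 0 c - v 0 c)).
  by apply: integrable_sqr => //; rewrite compressor_varE ltry.
have [+ _] := @integral_affine _ _ _ nu (fun t => Q v t 0 c - v 0 c) 1 (v 0 c) _ isq
  (esym (fineK (integrable_fin_num measurableT isq))).
by congr integrable; apply/funext => t /=; rewrite mul1r addrC subrK.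
Qed.

(** Bias-variance decomposition: [b + a * Q] is the constant [b + a * v] plus the centred term
    [a * (Q - v)]. *)
Lemma compressor_affine_sqr v c (a b : R) :
  (\int[nu]_t ((b + a * Q v t 0 c) ^+ 2)%R%:E =
   ((b + a * v 0 c) ^+ 2 + a ^+ 2 * compressor_var v c)%R%:E)%E.
Proof.
have [_ e0] := compressor_affine v c a (- (a * v 0 c)); rewrite addNr in e0.
have mphi : measurable_fun setT (fun t => - (a * v 0 c) + a * Q v t 0 c).
  apply: measurable_funD => //; apply: measurable_funM => //.
  exact: measurable_compressor.
have e2 : (\int[nu]_t ((- (a * v 0 c) + a * Q v t 0 c) ^+ 2)%R%:E =
    (a ^+ 2 * compressor_var v c)%:E)%E.
  rewrite EFinM -compressor_varE -ge0_integralZl//; last 2 first.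
  - by move=> t _; rewrite lee_fin sqr_ge0.
  - by rewrite lee_fin sqr_ge0.
  by apply: eq_integral => t _; rewrite -EFinM; congr _%:E; ring.
have := integral_sqr_shift (b + a * v 0 c) mphi e0 e2.
rewrite mulr0 addr0 => <-.
by apply: eq_integral => t _; congr _%:E; ring.
Qed.

End compressor.

(** * The noise of one iteration *)

Section noise.
Context (R : realType) (dO dX : measure_display) (Omega : measurableType dO)
  (Xi : measurableType dX).
Variables (P : probability Omega R) (nu : probability Xi R) (n m : nat).
Hypothesis m_gt0 : (0 < m)%N.
Variables (j : 'I_n -> Omega -> 'I_m) (xi : 'I_n -> Omega -> Xi).
Hypothesis mj : forall i a, measurable (j i @^-1` [set a]).
Hypothesis mxi : forall i, measurable_fun setT (xi i).
Variable G : set (set Omega).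
Hypothesis mG : G `<=` measurable.
Hypothesis fresh : forall A (J : 'I_n -> 'I_m) (B : 'I_n -> set Xi), <<s G >> A ->
     (forall i, measurable (B i)) ->
     P (A `&` [set o | forall i, j i o = J i /\ B i (xi i o)])
     = (P A * \prod_(i < n) ((m%:R^-1)%:E * nu (B i)))%E.

(** Sets of admissible indices, rather than single indices, keep cylinders closed under intersection
    and allow a worker to be left unconstrained. *)
Definition cylinder (S : 'I_n -> {set 'I_m}) (B : 'I_n -> set Xi) : set Omega :=
  [set o | forall i, j i o \in S i /\ B i (xi i o)].

(** A pi-system generating the noise of the workers selected by [r]: [predT] gives the whole noise
    of the iteration, [pred1 i] that of one worker. *)
Definition noise_gen (r : pred 'I_n) : set (set Omega) :=
  [set E | exists S B, [/\ forall i, measurable (B i),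
    forall i, ~~ r i -> S i = finset.setT /\ B i = setT & E = cylinder S B]].

Lemma measurable_cylinder S B :
  (forall i, measurable (B i)) -> measurable (cylinder S B).
Proof.
move=> mB.
rewrite (_ : cylinder S B = \bigcap_(i in [set: 'I_n])
   ((\bigcup_(a in [set` S i]) j i @^-1` [set a]) `&` xi i @^-1` B i)).
  apply: fin_bigcap_measurable => // i _; apply: measurableI.
    exact: fin_bigcup_measurable.
  by rewrite -[X in measurable X]setTI; exact: mxi.
apply/seteqP; split => o /= h.
  by move=> i _; have [h1 h2] := h i; split => //; exists (j i o).
by move=> i; have [[a/= aS ja] ?] := h i Logic.I; rewrite ja.
Qed.

Definition cylinder_weight (S : 'I_n -> {set 'I_m}) (B : 'I_n -> set Xi) i : R :=
  #|S i|%:R / m%:R * fine (nu (B i)).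

(** [fresh] prescribes the probability for one index per worker. Summing it over all index choices
    in the product of the [S i] and exchanging sum and product yields one weight per worker. *)
Lemma cylinderE A S B : <<s G >> A -> (forall i, measurable (B i)) ->
  P (A `&` cylinder S B) = (P A * (\prod_i cylinder_weight S B i)%:E)%E.
Proof.
move=> GA mB.
have mA := g_sigma_algebra_sub_measurable mG GA.
(* The indices of all workers form a single variable with finitely many values, whose fibres
   partition the event. *)
pose J o : {ffun 'I_n -> 'I_m} := [ffun i => j i o].
have JE o f : J o = f <-> forall i, j i o = f i.
  split; first by move=> <- i; rewrite ffunE.
  by move=> h; apply/ffunP => i; rewrite ffunE.
have mJ f : measurable (J @^-1` [set f]).
  rewrite (_ : _ @^-1` _ = \bigcap_(i in [set: 'I_n]) j i @^-1` [set f i]).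
    exact: fin_bigcap_measurable.
  by apply/seteqP; split => o /= /[dup] h; rewrite ?JE => h' i;
    [move=> _ /=|]; exact: h'.
rewrite (measure_fin_partition P (J := J))//; last first.
  by apply: measurableI => //; exact: measurable_cylinder.
transitivity (\sum_(f in family (fun i => mem (S i)))
    (fine (P A) * \prod_i (m%:R^-1 * fine (nu (B i))))%:E)%E.
  rewrite [RHS]big_mkcond/=; apply: eq_bigr => f _.
  case: ifPn => [/familyP fS|fS].
    rewrite EFinM fineK ?fin_num_measure// -prodEFin.
    under eq_bigr do rewrite EFinM fineK ?fin_num_measure//.
    rewrite -(@fresh A f B GA mB); congr (P _); apply/seteqP; split => o.
      move=> [[Ao h] /JE Jo]; split => // i; split => //; exact: (h i).2.
    move=> [Ao h]; split; last by apply/JE => i; exact: (h i).1.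
    split => // i; split; last exact: (h i).2.
    by rewrite (h i).1; exact: fS.
  rewrite (_ : _ `&` _ = set0) ?measure0//; apply/seteqP; split => // o.
  move=> [[_ h] /JE Jo]; move/negP: fS; apply; apply/familyP => i.
  by rewrite -Jo; exact: (h i).1.
rewrite sumEFin -big_distrr/= EFinM fineK ?fin_num_measure//.
congr (_ * _%:E)%E.
rewrite -(bigA_distr_big_dep (fun i a => a \in S i)
  (fun i _ => m%:R^-1 * fine (nu (B i)))).
by apply: eq_bigr => i _; rewrite sumr_const /cylinder_weight -[LHS]mulr_natl mulrA.
Qed.

Lemma cylinder_prob S B : (forall i, measurable (B i)) ->
  P (cylinder S B) = (\prod_i cylinder_weight S B i)%:E.
Proof.
move=> mB.
by have := @cylinderE setT S B (@g_sigma_algebraT _ G) mB; rewrite setTI probability_setT mul1e.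
Qed.

Lemma cylinder_weightT S B i : S i = finset.setT -> B i = setT ->
  cylinder_weight S B i = 1.
Proof.
move=> SE BE; rewrite /cylinder_weight SE BE probability_setT/= mulr1.
by rewrite cardsT card_ord divff// pnatr_eq0 -lt0n.
Qed.

Lemma noise_gen_measurable r : noise_gen r `<=` measurable.
Proof. by move=> _ [S [B [mB _ ->]]]; exact: measurable_cylinder. Qed.

Lemma cylinderI S1 B1 S2 B2 : cylinder S1 B1 `&` cylinder S2 B2 =
  cylinder (fun i => finset.setI (S1 i) (S2 i)) (fun i => B1 i `&` B2 i).
Proof.
apply/seteqP; split => o.
  move=> [h1 h2] i; rewrite inE.
  by have [-> ?] := h1 i; have [-> ?] := h2 i.
by move=> h; split => i; have := h i; rewrite inE => -[/andP[? ?] []].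
Qed.

Lemma noise_gen_setI r : setI_closed (noise_gen r).
Proof.
move=> _ _ [S1 [B1 [mB1 r1 ->]]] [S2 [B2 [mB2 r2 ->]]].
rewrite cylinderI; eexists; eexists; split; last reflexivity.
  by move=> i; exact: measurableI.
move=> i ri; have [-> ->] := r1 _ ri; have [-> ->] := r2 _ ri.
by rewrite finset.setIT setIT.
Qed.

Lemma past_noise_indep (r : pred 'I_n) A E : <<s G >> A -> noise_gen r E ->
  P (A `&` E) = (P A * P E)%E.
Proof.
by move=> GA [S [B [mB _ ->]]]; rewrite cylinderE// cylinder_prob.
Qed.

(** The probability of a cylinder is a product over workers. For disjoint groups, each worker is
    constrained by at most one of the two cylinders and the other weight is 1, so the products
    multiply. *)
Lemma noise_indep (r1 r2 : pred 'I_n) E1 E2 : (forall i, r1 i -> ~~ r2 i) ->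
  <<s noise_gen r1 >> E1 -> noise_gen r2 E2 -> P (E1 `&` E2) = (P E1 * P E2)%E.
Proof.
(* The events are swapped because [indep_g_sigma_algebra] extends the second one to the generated
   sigma-algebra. *)
move=> r12 nE1 nE2; rewrite setIC muleC.
apply: (@indep_g_sigma_algebra _ _ _ _ _ (noise_gen r1)) => //.
- exact: noise_gen_measurable nE2.
- exact: noise_gen_measurable.
- exact: noise_gen_setI.
move=> E {nE1} [S1 [B1 [mB1 n1 ->]]].
move: nE2 => [S2 [B2 [mB2 n2 ->]]].
rewrite cylinderI !cylinder_prob//; last by move=> i; exact: measurableI.
rewrite -EFinM -big_split/=; congr _%:E; apply: eq_bigr => i _.
have [/r12 ri|ri] := boolP (r1 i).
  have [S2E B2E] := n2 _ ri.
  rewrite (cylinder_weightT S2E B2E) mul1r /cylinder_weight S2E B2E.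
  by rewrite finset.setTI setTI.
have [S1E B1E] := n1 _ ri.
rewrite (cylinder_weightT S1E B1E) mulr1 /cylinder_weight S1E B1E.
by rewrite finset.setIT setIT.
Qed.

Local Notation noise r := (g_sigma_algebraType (noise_gen r)).

Lemma noise_index_measurable (r : pred 'I_n) i (a : 'I_m) : r i ->
  measurable (j i @^-1` [set a] : set (noise r)).
Proof.
move=> ri; apply: sub_sigma_algebra.
exists (fun i' => if i' == i then [set a]%SET else finset.setT), (fun=> setT).
split => //.
  by move=> i' ri'; split => //; case: eqP => // ii'; rewrite ii' ri in ri'.
apply/seteqP; split => o /=.
  by move=> <- i'; split => //; case: eqP => [->|]; rewrite ?inE.
by move=> /(_ i)[]; rewrite eqxx inE => /eqP.
Qed.

Lemma noise_seed_measurable (r : pred 'I_n) i : r i ->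
  measurable_fun setT (xi i : noise r -> Xi).
Proof.
move=> ri _ B mB; rewrite setTI; apply: sub_sigma_algebra.
exists (fun=> finset.setT), (fun i' => if i' == i then B else setT).
split => //.
- by move=> i'; case: ifP.
- by move=> i' ri'; split => //; case: eqP => // ii'; rewrite ii' ri in ri'.
apply/seteqP; split => o /=.
  by move=> Bo i'; rewrite inE; split => //; case: eqP => [->|].
by move=> /(_ i)[_]; rewrite eqxx.
Qed.

Lemma measurable_noise_fun (d1 d2 : measure_display) (T1 : measurableType d1)
    (T2 : measurableType d2) (r : pred 'I_n) i (psi : 'I_m -> T1 * Xi -> T2) :
  r i -> (forall a, measurable_fun setT (psi a)) ->
  measurable_fun [set: T1 * noise r] (fun z => psi (j i z.2) (z.1, xi i z.2)).
Proof.
move=> ri mpsi.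
pose F a (z : T1 * noise r) := psi a (z.1, xi i z.2).
apply: (@measurable_fun_fin_choice _ _ (T1 * noise r)%type T2 _
  (fun z => j i z.2) F).
  move=> a; rewrite -[X in measurable X]setTI.
  exact: (@measurable_snd _ _ T1 (noise r) measurableT _ (noise_index_measurable a ri)).
move=> a; apply: measurableT_comp => //.
apply: measurable_fun_pair => //.
apply: (measurableT_comp (noise_seed_measurable ri)); exact: measurable_snd.
Qed.

(** The event is a cylinder in which every other worker is unconstrained and has weight 1. *)
Lemma worker_law i a (B : set Xi) : measurable B ->
  P (j i @^-1` [set a] `&` xi i @^-1` B) = ((m%:R^-1)%:E * nu B)%E.
Proof.
move=> mB.
pose S i' : {set 'I_m} := if i' == i then [set a]%SET else finset.setT.
pose C i' : set Xi := if i' == i then B else setT.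
have mC i' : measurable (C i') by rewrite /C; case: ifP.
rewrite (_ : _ `&` _ = cylinder S C).
  rewrite (cylinder_prob)// (bigD1 i)//= big1 ?mulr1.
    rewrite /cylinder_weight /S /C eqxx cards1 mul1r EFinM fineK//.
    exact: fin_num_measure.
  by move=> i' ii'; rewrite cylinder_weightT// /S /C (negbTE ii').
apply/seteqP; split => o /=.
  move=> [ja Bo] i'; rewrite /S /C; case: eqP => [->|_]; last by rewrite inE.
  by rewrite inE ja eqxx.
by move=> /(_ i); rewrite /S /C eqxx inE => -[/eqP].
Qed.

(** The space is split by the value of the index; on each piece the image of the restricted measure
    under the seed is [nu] scaled by [m%:R^-1]. *)
Lemma ge0_worker_expectation i (psi : 'I_m -> Xi -> \bar R) :
  (forall a, measurable_fun setT (psi a)) -> (forall a t, 0 <= psi a t)%E ->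
  (\int[P]_o psi (j i o) (xi i o) =
   \sum_a ((m%:R^-1)%:E * \int[nu]_t psi a t))%E.
Proof.
move=> mpsi psi0.
have mji a : measurable (j i @^-1` [set a]) by [].
have mf : measurable_fun setT (fun o => psi (j i o) (xi i o)).
  apply: (measurable_fun_fin_choice (J := j i) (F := fun a o => psi a (xi i o))) => //.
  by move=> a; exact: measurableT_comp.
have -> : [set: Omega] = \big[setU/set0]_(a <- index_enum 'I_m) j i @^-1` [set a].
  rewrite -bigcup_seq; apply/seteqP; split => // o _.
  by exists (j i o) => //=; rewrite mem_index_enum.
rewrite ge0_integral_bigsetU//; last 3 first.
- exact: index_enum_uniq.
- by move=> a1 a2 _ _ [w [/= <- <-]].
- exact: measurable_funTS.
apply: eq_bigr => a _.
transitivity (\int[P]_(o in j i @^-1` [set a]) psi a (xi i o))%E.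
  by apply: eq_integral => o; rewrite inE => /= ->.
rewrite -(ge0_integral_mrestr P (mji a))//; last exact: measurableT_comp.
have k0 : 0 <= m%:R^-1 :> R by rewrite invr_ge0.
pose k : {nonneg R} := NngNum k0.
rewrite -[RHS](@ge0_integral_mscale _ _ _ nu _ measurableT k)//.
transitivity (\int[pushforward (mrestr P (mji a)) (xi i)]_t psi a t)%E.
  rewrite (ge0_integral_pushforward (mxi i) (mrestr P (mji a)) measurableT)//.
apply: eq_measure_integral => B mB _.
by rewrite [LHS](_ : _ = P (xi i @^-1` B `&` j i @^-1` [set a]))// setIC worker_law.
Qed.

(** The signed version: the nonnegative one is applied to the positive and negative parts, whose
    integrals are finite by integrability. *)
Lemma worker_expectation i (psi : 'I_m -> Xi -> R) (e : 'I_m -> R) :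
  (forall a, measurable_fun setT (psi a)) ->
  (forall a, nu.-integrable setT (EFin \o psi a)) ->
  (forall a, \int[nu]_t (psi a t)%:E = (e a)%:E)%E ->
  (\int[P]_o (psi (j i o) (xi i o))%:E = (m%:R^-1 * \sum_a e a)%:E)%E.
Proof.
move=> mpsi ipsi psie.
have mE a : measurable_fun setT (EFin \o psi a) by exact/measurable_EFinP.
rewrite integralE.
have Ep : (\int[P]_o (EFin \o (fun o => psi (j i o) (xi i o)))^\+ o =
    \sum_a ((m%:R^-1)%:E * \int[nu]_t (EFin \o psi a)^\+ t))%E.
  rewrite -(@ge0_worker_expectation i (fun a => (EFin \o psi a)^\+%E)).
  - by apply: eq_integral => o _; rewrite !funeposE.
  - by move=> a; exact: measurable_funepos.
  - by move=> a t; exact: funepos_ge0.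
have En : (\int[P]_o (EFin \o (fun o => psi (j i o) (xi i o)))^\- o =
    \sum_a ((m%:R^-1)%:E * \int[nu]_t (EFin \o psi a)^\- t))%E.
  rewrite -(@ge0_worker_expectation i (fun a => (EFin \o psi a)^\-%E)).
  - by apply: eq_integral => o _; rewrite !funenegE.
  - by move=> a; exact: measurable_funeneg.
  - by move=> a t; exact: funeneg_ge0.
rewrite [X in (X - _)%E]Ep [X in (_ - X)%E]En {Ep En}.
have pfin a := integrable_pos_fin_num measurableT (ipsi a).
have nfin a := integrable_neg_fin_num measurableT (ipsi a).
under eq_bigr do rewrite -(fineK (pfin _)) -EFinM.
under [X in (_ - X)%E]eq_bigr do rewrite -(fineK (nfin _)) -EFinM.
rewrite !sumEFin -EFinB -sumrB big_distrr; congr _%:E.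
apply: eq_bigr => a _ /=; rewrite -mulrBr; congr (_ * _).
by apply: EFin_inj; rewrite EFinB !fineK -?[RHS]psie ?[RHS]integralE.
Qed.

Lemma measurable_noise_sub (r : pred 'I_n) d2 (T2 : measurableType d2)
    (f : Omega -> T2) :
  measurable_fun [set: noise r] f -> measurable_fun setT f.
Proof.
move=> mf; have mid : measurable_fun setT (id : Omega -> noise r).
  by apply: measurable_id_g_sigma; exact: noise_gen_measurable.
exact: (measurableT_comp mf mid).
Qed.

(* One [Z i] at a time is integrated with the others frozen, so only the Tonelli
   form of independence is needed and no cross term [Z i * Z k] appears. *)
Lemma integral_sqr_sum_noise (Z : 'I_n -> Omega -> R) (s : 'I_n -> R) (a : R)
    (l : seq 'I_n) :
  (forall (r : pred 'I_n) i, r i -> measurable_fun [set: noise r] (Z i)) ->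
  (forall i, \int[P]_o (Z i o)%:E = 0)%E ->
  (forall i, \int[P]_o (Z i o ^+ 2)%:E = (s i)%:E)%E ->
  uniq l ->
  (\int[P]_o ((a + \sum_(i <- l) Z i o) ^+ 2)%R%:E =
   (a ^+ 2 + \sum_(i <- l) s i)%R%:E)%E.
Proof.
move=> mZ Z0 Z2; elim: l => [_|i l IH /= /andP[il ul]].
  under eq_integral do rewrite big_nil addr0.
  by rewrite big_nil addr0 integral_cst_probability.
have mS : measurable_fun [set: noise (mem l)] (fun o => a + \sum_(k <- l) Z k o).
  apply: measurable_funD => //.
  (* [Z k] is known to be measurable for the noise of [l] only when [k] belongs to [l]; the guard
     gives a family measurable for every [k]. *)
  rewrite (_ : (fun o => _) =
      (fun o => \sum_(k <- l) (if k \in l then Z k o else 0))); last first.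
    by apply/funext => o; apply: eq_big_seq => k ->.
  apply: measurable_sum => k; have [kl|kl] := boolP (k \in l).
    exact: (mZ (mem l) k kl).
  exact: measurable_cst.
pose f (o o' : Omega) := (((a + \sum_(k <- l) Z k o) + Z i o') ^+ 2)%:E.
transitivity (\int[P]_o f o o)%E.
  by apply: eq_integral => o _; rewrite /f big_cons (addrC (Z i o)) addrA.
rewrite (@ge0_integral_freeze _ _ _ P (noise_gen (mem l)) (noise_gen (pred1 i))).
- under eq_integral.
    move=> o _; rewrite (integral_sqr_shift _ _ (Z0 i) (Z2 i)); last first.
      by apply: (measurable_noise_sub (mZ (pred1 i) i _)) => /=.
    over.
  under eq_integral do rewrite mulr0 addr0 EFinD.
  rewrite ge0_integralD//; last 3 first.
  + by move=> o _; rewrite lee_fin sqr_ge0.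
  + apply/measurable_EFinP/measurable_funX; exact: (measurable_noise_sub mS).
  + by move=> o _; rewrite -Z2; apply: integral_ge0 => w _; rewrite lee_fin sqr_ge0.
  by rewrite IH// integral_cst_probability big_cons -EFinD (addrC (s i)) addrA.
- exact: noise_gen_measurable.
- exact: noise_gen_measurable.
- exact: noise_gen_setI.
- move=> A B GA HB; apply: (noise_indep _ GA HB).
  by move=> k kl /=; apply/eqP => ki; move/negP: il; apply; rewrite -ki; exact: kl.
- apply/measurable_EFinP/measurable_funX; apply: measurable_funD.
    exact: (measurableT_comp mS measurable_fst).
  by apply: (measurableT_comp (mZ (pred1 i) i _) measurable_snd) => /=.
- by move=> o o'; rewrite lee_fin sqr_ge0.
Qed.

Variables (d : nat) (Q : 'rV[R]_d -> Xi -> 'rV[R]_d) (omega : R).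
Hypothesis hQ : unbiased_compressor nu Q omega.
Variable D : 'I_n -> 'I_m -> 'rV[R]_d.

Let QD i o : 'rV[R]_d := Q (D i (j i o)) (xi i o).
Let mean i : 'rV[R]_d := mean_vec (D i).

Let mQD (r : pred 'I_n) i (a b : R) c : r i ->
  measurable_fun [set: noise r] (fun o => b + a * QD i o 0 c).
Proof.
move=> ri; apply: measurable_funD => //; apply: measurable_funM => //.
pose F e (o : noise r) := Q (D i e) (xi i o) 0 c.
apply: (@measurable_fun_fin_choice _ _ (noise r) _ _ (j i) F) => e.
  exact: noise_index_measurable.
have ms : measurable_fun setT (xi i : noise r -> Xi) by exact: noise_seed_measurable.
exact: (measurableT_comp (measurable_compressor hQ (D i e) c) ms).
Qed.

Let worker_mean i c (a b : R) :
  (\int[P]_o (b + a * QD i o 0 c)%R%:E = (b + a * mean i 0 c)%R%:E)%E.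
Proof.
rewrite (worker_expectation i
  (psi := fun e t => b + a * Q (D i e) t 0 c)
  (e := fun e => b + a * D i e 0 c)).
- rewrite mean_vecE big_split/= sumr_const card_ord -big_distrr/=; congr _%:E.
  rewrite mulrDr -[b *+ m]mulr_natl mulrA mulVf ?mul1r ?pnatr_eq0 -?lt0n//.
  by rewrite mulrCA.
- move=> e; apply: measurable_funD => //; apply: measurable_funM => //.
  exact: measurable_compressor hQ _ _.
- by move=> e; exact: (compressor_affine hQ (D i e) c a b).1.
- by move=> e; exact: (compressor_affine hQ (D i e) c a b).2.
Qed.

(** The second moment of [b + a * QD] in coordinate [c]: the average over the index of squared mean
    plus compression variance. *)
Let moment i c (a b : R) : R := m%:R^-1 *
  \sum_e ((b + a * D i e 0 c) ^+ 2 + a ^+ 2 * compressor_var nu Q (D i e) c).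

Let worker_sqr_coord i c (a b : R) :
  (\int[P]_o ((b + a * QD i o 0 c) ^+ 2)%R%:E = (moment i c a b)%:E)%E.
Proof.
have mpsi e : measurable_fun setT (fun t => (b + a * Q (D i e) t 0 c) ^+ 2).
  apply: measurable_funX; apply: measurable_funD => //; apply: measurable_funM => //.
  exact: measurable_compressor hQ _ _.
apply: (worker_expectation i
  (psi := fun e t => (b + a * Q (D i e) t 0 c) ^+ 2)) => //.
- move=> e.
  apply: (integrable_ge0_fin _ _ (compressor_affine_sqr hQ (D i e) c a b)) => //.
  by move=> t; rewrite sqr_ge0.
- by move=> e; exact: (compressor_affine_sqr hQ (D i e) c a b).
Qed.

Let moment_le i (b : 'rV[R]_d) a :
  \sum_c moment i c a (b 0 c) <= m%:R^-1 *
    \sum_e (enorm (b + a *: D i e) ^+ 2 + a ^+ 2 * omega * enorm (D i e) ^+ 2).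
Proof.
rewrite -big_distrr/= ler_wpM2l ?invr_ge0// exchange_big/=.
apply: ler_sum => e _; rewrite big_split/= lerD//.
  by rewrite sqr_enorm; apply: ler_sum => c _; rewrite !mxE.
by rewrite -big_distrr/= -mulrA ler_wpM2l ?sqr_ge0// (compressor_var_le hQ).
Qed.

Lemma worker_sqr_le i (a : R) (b : 'rV[R]_d) :
  (\int[P]_o (enorm (b + a *: Q (D i (j i o)) (xi i o)) ^+ 2)%:E <=
   (m%:R^-1 * \sum_e (enorm (b + a *: D i e) ^+ 2
      + a ^+ 2 * omega * enorm (D i e) ^+ 2))%:E)%E.
Proof.
apply: (@le_trans _ _ (\sum_c moment i c a (b 0 c))%:E); last first.
  by rewrite lee_fin moment_le.
rewrite -sumEFin; under [leRHS]eq_bigr do rewrite -worker_sqr_coord.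
rewrite -ge0_integral_sum//; last 2 first.
- move=> c; apply/measurable_EFinP/measurable_funX.
  exact: (measurable_noise_sub (mQD (r := predT) a (b 0 c) c isT)).
- by move=> c o _; rewrite lee_fin sqr_ge0.
rewrite le_eqVlt; apply/orP; left; apply/eqP; apply: eq_integral => o _.
by rewrite sqr_enorm sumEFin; congr _%:E; apply: eq_bigr => c _; rewrite !mxE.
Qed.

(** The centred contribution of worker [i] to coordinate [c] of the average, put in the shape
    [b + a * QD] so that the worker moments apply directly. *)
Let Z c i o : R := - (n%:R^-1 * mean i 0 c) + n%:R^-1 * QD i o 0 c.

Let Z0 c i : (\int[P]_o (Z c i o)%:E = 0)%E.
Proof. by rewrite worker_mean addNr. Qed.

Let mZ c i : measurable_fun setT (Z c i).
Proof. exact: (measurable_noise_sub (mQD (r := predT) _ _ c isT)). Qed.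

Let round_coord b o c :
  (b + mean_vec (fun i => QD i o)) 0 c = (b + mean_vec mean) 0 c + \sum_i Z c i o.
Proof.
rewrite [LHS]mxE [(b + mean_vec mean) 0 c]mxE !mean_vecE -addrA; congr (_ + _).
by rewrite /Z big_split/= sumrN !big_distrr/= addrA subrr add0r.
Qed.

(** The coordinate is its claimed mean plus a finite sum of centred, square-integrable terms. *)
Lemma round_mean (b : 'rV[R]_d) c :
  P.-integrable setT
    (fun o => ((b + mean_vec (fun i => Q (D i (j i o)) (xi i o))) 0 c)%:E) /\
  (\int[P]_o ((b + mean_vec (fun i => Q (D i (j i o)) (xi i o))) 0 c)%:E =
   ((b + mean_vec (fun i => mean_vec (D i))) 0 c)%:E)%E.
Proof.
have iZ i : P.-integrable setT (EFin \o Z c i).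
  by apply: integrable_sqr => //; rewrite worker_sqr_coord ltry.
have iS : P.-integrable setT (EFin \o (fun o => \sum_i Z c i o)).
  rewrite (_ : _ \o _ = (fun o => \sum_i (EFin \o Z c i) o)%E).
    exact: integrable_sum.
  by apply/funext => o /=; rewrite sumEFin.
have S0 : (\int[P]_o (\sum_i Z c i o)%R%:E = 0)%E.
  under eq_integral do rewrite -sumEFin.
  by rewrite (integral_sum measurableT iZ) big1// => i _; exact: Z0.
have [i1 e1] := integral_affine 1 ((b + mean_vec mean) 0 c) iS S0.
have E : (fun o => ((b + mean_vec (fun i => QD i o)) 0 c)%:E) =
    (fun o => ((b + mean_vec mean) 0 c + 1 * \sum_i Z c i o)%:E).
  by apply/funext => o; rewrite round_coord mul1r.
by split; rewrite E// e1 mulr0 addr0.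
Qed.

(** In each coordinate the workers' variances add up, by independence. Summing over coordinates
    bounds a worker's variance by the spread of [D i] over the index plus the compression error;
    averaging over workers contributes the squared [n%:R^-1]. *)
Lemma round_sqr_le (b g : 'rV[R]_d) :
  (\int[P]_o
     (enorm (b + mean_vec (fun i => Q (D i (j i o)) (xi i o)) - g) ^+ 2)%:E <=
   (enorm (b + mean_vec (fun i => mean_vec (D i)) - g) ^+ 2
    + n%:R^-1 ^+ 2 * \sum_i (m%:R^-1 * \sum_e (enorm (D i e - mean_vec (D i)) ^+ 2
       + omega * enorm (D i e) ^+ 2)))%:E)%E.
Proof.
pose a c := (b + mean_vec mean - g) 0 c.
have coord c o : (b + mean_vec (fun i => QD i o) - g) 0 c =
    a c + \sum_(i <- index_enum 'I_n) Z c i o.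
  by rewrite [LHS]mxE round_coord /a [in RHS]mxE addrAC.
pose sZ c i := moment i c n%:R^-1 (- (n%:R^-1 * mean i 0 c)).
have sqrS c : (\int[P]_o ((a c + \sum_(i <- index_enum 'I_n) Z c i o) ^+ 2)%R%:E =
    (a c ^+ 2 + \sum_(i <- index_enum 'I_n) sZ c i)%R%:E)%E.
  apply: (integral_sqr_sum_noise).
  - by move=> r i ri; exact: mQD.
  - by move=> i; exact: Z0.
  - by move=> i; exact: worker_sqr_coord.
  - exact: index_enum_uniq.
apply: (@le_trans _ _ (\sum_c (a c ^+ 2 + \sum_i sZ c i))%:E).
  rewrite -sumEFin; under [leRHS]eq_bigr do rewrite -sqrS.
  rewrite -ge0_integral_sum//; last 2 first.
  - move=> c; apply/measurable_EFinP/measurable_funX; apply: measurable_funD => //.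
    exact: measurable_sum.
  - by move=> c o _; rewrite lee_fin sqr_ge0.
  rewrite le_eqVlt; apply/orP; left; apply/eqP; apply: eq_integral => o _.
  by rewrite sqr_enorm sumEFin; congr _%:E; apply: eq_bigr => c _; rewrite -coord.
rewrite lee_fin big_split/= sqr_enorm lerD// exchange_big/= big_distrr/=.
apply: ler_sum => i _.
under eq_bigr => c _.
  (* The shift is recognised as a coordinate of one vector, the form that [moment_le] expects. *)
  rewrite /sZ (_ : - (n%:R^-1 * _) = (- (n%:R^-1 *: mean i)) 0 c); last by rewrite !mxE.
  over.
apply: (le_trans (moment_le i (- (n%:R^-1 *: mean i)) n%:R^-1)).
rewrite [leRHS]mulrCA ler_wpM2l ?invr_ge0// big_distrr/=.
apply: ler_sum => e _.
rewrite mulrDr lerD//; last by rewrite -mulrA.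
rewrite !sqr_enorm big_distrr/=; apply: ler_sum => c _.
by rewrite !mxE le_eqVlt; apply/orP; left; apply/eqP; ring.
Qed.

End noise.

(** * Conditional expectations *)

Section cexp_calculus.
Context (R : realType) (dO : measure_display) (Omega : measurableType dO).
Variables (P : probability Omega R) (G : set (set Omega)).
Hypothesis mG : G `<=` measurable.
Local Notation OG := (g_sigma_algebraType G).

Lemma measurable_wrtP (Y : Omega -> R) :
  measurable_wrt <<s G >> Y <-> measurable_fun [set: OG] Y.
Proof.
split=> [h _ B mB|mY B mB]; first by rewrite setTI; exact: h.
by have := mY measurableT B mB; rewrite setTI.
Qed.

Lemma measurable_wrt_fun (Y : Omega -> R) :
  measurable_wrt <<s G >> Y -> measurable_fun setT Y.
Proof.
move=> /measurable_wrtP mY.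
exact: (measurableT_comp mY (measurable_id_g_sigma mG)).
Qed.

Lemma cexp_nneg_le0 : cexp_nneg_le P <<s G >> (fun=> 0) (fun=> 0).
Proof.
exists (fun=> 0); last exact: aeW.
by split => //; split => //; apply/measurable_wrtP; exact: measurable_cst.
Qed.

(** The sum of two versions is a version for the sum, and both almost sure bounds hold together
    almost surely. *)
Lemma cexp_nneg_leD (X1 Z1 X2 Z2 : Omega -> R) :
  cexp_nneg_le P <<s G >> X1 Z1 -> cexp_nneg_le P <<s G >> X2 Z2 ->
  cexp_nneg_le P <<s G >> (fun o => X1 o + X2 o) (fun o => Z1 o + Z2 o).
Proof.
move=> [Y1 [[mX1 X10] [mY1 Y10] XY1] YZ1] [Y2 [[mX2 X20] [mY2 Y20] XY2] YZ2].
exists (fun o => Y1 o + Y2 o); last first.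
  by move: YZ1 YZ2; apply: filterS2 => o; exact: lerD.
split.
- by split => [|o]; [exact: measurable_funD|exact: addr_ge0].
- split => [|o]; last exact: addr_ge0.
  apply/measurable_wrtP/measurable_funD; exact/measurable_wrtP.
move=> A GA; have mA := g_sigma_algebra_sub_measurable mG GA.
have mY1' := measurable_wrt_fun mY1; have mY2' := measurable_wrt_fun mY2.
under eq_integral do rewrite EFinD.
under [RHS]eq_integral do rewrite EFinD.
rewrite !ge0_integralD ?XY1 ?XY2//;
  do ?[by move=> o _; rewrite lee_fin];
  by apply/measurable_EFinP; exact: measurable_funTS.
Qed.

Lemma cexp_nneg_leZ (X Z : Omega -> R) (k : R) : 0 <= k ->
  cexp_nneg_le P <<s G >> X Z ->
  cexp_nneg_le P <<s G >> (fun o => k * X o) (fun o => k * Z o).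
Proof.
move=> k0 [Y [[mX X0] [mY Y0] XY] YZ].
exists (fun o => k * Y o); last first.
  by move: YZ; apply: filterS => o; exact: ler_wpM2l.
split.
- by split => [|o]; [exact: measurable_funM|exact: mulr_ge0].
- split => [|o]; last exact: mulr_ge0.
  by apply/measurable_wrtP/measurable_funM => //; exact/measurable_wrtP.
move=> A GA; have mA := g_sigma_algebra_sub_measurable mG GA.
have mY' := measurable_wrt_fun mY.
under eq_integral do rewrite EFinM.
under [RHS]eq_integral do rewrite EFinM.
rewrite !ge0_integralZl_EFin ?XY//;
  do ?[by move=> o _; rewrite lee_fin];
  by apply/measurable_EFinP; exact: measurable_funTS.
Qed.

Lemma cexp_nneg_le_sum (I : Type) (r : seq I) (X Z : I -> Omega -> R) :
  (forall i, cexp_nneg_le P <<s G >> (X i) (Z i)) ->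
  cexp_nneg_le P <<s G >> (fun o => \sum_(i <- r) X i o)
    (fun o => \sum_(i <- r) Z i o).
Proof.
move=> XZ; elim: r => [|i r IH].
  under eq_fun do rewrite big_nil.
  under [X in cexp_nneg_le _ _ _ X]eq_fun do rewrite big_nil.
  exact: cexp_nneg_le0.
under eq_fun do rewrite big_cons.
under [X in cexp_nneg_le _ _ _ X]eq_fun do rewrite big_cons.
exact: cexp_nneg_leD.
Qed.

Lemma cexp_nneg_le_trans (X Z Z' : Omega -> R) : (forall o, Z o <= Z' o) ->
  cexp_nneg_le P <<s G >> X Z -> cexp_nneg_le P <<s G >> X Z'.
Proof.
move=> ZZ' [Y XY YZ]; exists Y => //.
by move: YZ; apply: filterS => o /le_trans; apply.
Qed.

Variable H : set (set Omega).
Hypotheses (mH : H `<=` measurable) (HI : setI_closed H).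
Hypothesis ind : forall A B, <<s G >> A -> H B -> P (A `&` B) = (P A * P B)%E.
Local Notation OH := (g_sigma_algebraType H).

(** The bound [Z] makes the inner integral finite for every state, so its [fine] is a genuine
    version, and it satisfies the bound at every outcome. *)
Lemma cexp_nneg_le_freeze (f : Omega -> Omega -> R) (Z : Omega -> R) :
  measurable_fun [set: OG * OH] (fun z => f z.1 z.2) ->
  (forall o o', 0 <= f o o') ->
  (forall o, \int[P]_o' (f o o')%:E <= (Z o)%:E)%E ->
  cexp_nneg_le P <<s G >> (fun o => f o o) Z.
Proof.
move=> mf f0 fZ.
have fin o : (\int[P]_o' (f o o')%:E \is a fin_num)%E.
  rewrite ge0_fin_numE; first exact: le_lt_trans (fZ o) (ltry _).
  by apply: integral_ge0 => o' _; rewrite lee_fin.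
exists (fun o => fine (\int[P]_o' (f o o')%:E)); last first.
  by apply: aeW => o; rewrite -lee_fin fineK.
by apply: (is_cexp_nneg_freeze mG mH HI ind) => // o; rewrite fineK.
Qed.

(** [is_cexp] asks for finite versions for the positive and negative parts; each part is frozen
    separately and integrability of the sections gives finiteness. *)
Lemma is_cexp_freeze (f : Omega -> Omega -> R) (Y : Omega -> R) :
  measurable_fun [set: OG * OH] (fun z => f z.1 z.2) ->
  (forall o, P.-integrable setT (fun o' => (f o o')%:E)) ->
  (forall o, \int[P]_o' (f o o')%:E = (Y o)%:E)%E ->
  is_cexp P <<s G >> (fun o => f o o) Y.
Proof.
move=> mf fi fY.
pose pf o o' := Num.max (f o o') 0.
pose nf o o' := Num.max (- f o o') 0.
have pE o : (fun o' => (pf o o')%:E) = (fun o' => (f o o')%:E)^\+%E.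
  by apply/funext => o'; rewrite funeposE EFin_max.
have nE o : (fun o' => (nf o o')%:E) = (fun o' => (f o o')%:E)^\-%E.
  by apply/funext => o'; rewrite funenegE EFin_max.
have pfin o : (\int[P]_o' (pf o o')%:E \is a fin_num)%E.
  by rewrite pE; exact: integrable_pos_fin_num.
have nfin o : (\int[P]_o' (nf o o')%:E \is a fin_num)%E.
  by rewrite nE; exact: integrable_neg_fin_num.
exists (fun o => fine (\int[P]_o' (pf o o')%:E)).
exists (fun o => fine (\int[P]_o' (nf o o')%:E)).
split.
- apply: (is_cexp_nneg_freeze mG mH HI ind (f := pf)) => [|o o'|o].
  + exact: (measurable_funrpos mf).
  + by rewrite le_max lexx orbT.
  + by rewrite fineK.
- apply: (is_cexp_nneg_freeze mG mH HI ind (f := nf)) => [|o o'|o].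
  + exact: (measurable_funrneg mf).
  + by rewrite le_max lexx orbT.
  + by rewrite fineK.
- by move=> o; apply: EFin_inj; rewrite EFinB !fineK// pE nE -integralE fY.
Qed.

End cexp_calculus.

(** * Deterministic estimates *)

Section euclidean.
Context (R : realType) (d : nat).
Implicit Types u v w b : 'rV[R]_d.

(** In each coordinate the right side minus the left side is the square of [u + v - 2 * w]. *)
Lemma sqr_enormB_le u v w :
  enorm (u - v) ^+ 2 <= 2 * enorm (u - w) ^+ 2 + 2 * enorm (v - w) ^+ 2.
Proof.
rewrite !sqr_enorm !big_distrr/= -big_split/=; apply: ler_sum => c _.
rewrite !mxE; have := sqr_ge0 (u 0 c + v 0 c - 2 * w 0 c); nra.
Qed.

(** Bias-variance identity for the uniform law on indices: after centring at the mean, the cross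
    term sums to zero. *)
Lemma mean_sqr_enorm (m : nat) (u : 'I_m -> 'rV[R]_d) (b : 'rV[R]_d) (a : R) :
  (0 < m)%N ->
  m%:R^-1 * (\sum_e enorm (b + a *: u e) ^+ 2) =
  enorm (b + a *: mean_vec u) ^+ 2
  + a ^+ 2 * (m%:R^-1 * \sum_e enorm (u e - mean_vec u) ^+ 2).
Proof.
move=> m0; have m0' : m%:R != 0 :> R by rewrite pnatr_eq0 -lt0n.
under eq_bigr do rewrite sqr_enorm.
under [in RHS]eq_bigr do rewrite sqr_enorm.
rewrite sqr_enorm exchange_big/= [in RHS]exchange_big/= !big_distrr/= -big_split/=.
apply: eq_bigr => c _; rewrite !mxE !summxE.
set S := \sum_(i < m) u i 0 c; pose mu := m%:R^-1 * S.
transitivity (m%:R^-1 * \sum_(e < m) ((b 0 c + a * mu) ^+ 2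
    + 2 * a * (b 0 c + a * mu) * (u e 0 c - mu) + a ^+ 2 * (u e 0 c - mu) ^+ 2)).
  by congr (_ * _); apply: eq_bigr => e _; rewrite !mxE; ring.
rewrite !big_split/= -!big_distrr/= sumrB !sumr_const card_ord -/S.
under [in RHS]eq_bigr do rewrite !mxE summxE -/S -/mu.
rewrite -/mu -[mu *+ m]mulr_natl -[(b 0 c + a * mu) *+ m]mulr_natl.
have -> : S = m%:R * mu by rewrite mulrA divff// mul1r.
by clearbody mu; field.
Qed.

(** The left side equals [|b|^2 + 2 alpha <b, v> + alpha^2 (1 + omega) |v|^2]; replacing the last
    coefficient by [alpha] gives exactly the right side. *)
Lemma sqr_enorm_step_le b v (alpha omega : R) : alpha ^+ 2 * (1 + omega) <= alpha ->
  enorm (b + alpha *: v) ^+ 2 + alpha ^+ 2 * omega * enorm v ^+ 2 <=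
  (1 - alpha) * enorm b ^+ 2 + alpha * enorm (b + v) ^+ 2.
Proof.
move=> ha; rewrite !sqr_enorm !big_distrr/= -!big_split/=.
apply: ler_sum => c _; rewrite !mxE.
by have := sqr_ge0 (v 0 c); nra.
Qed.

End euclidean.

Lemma mean_vecD (R : realType) (d n : nat) (u v : 'I_n -> 'rV[R]_d) :
  mean_vec (fun i => u i + v i) = mean_vec u + mean_vec v.
Proof. by rewrite /mean_vec big_split/= scalerDr. Qed.

Lemma mean_vecB (R : realType) (d n : nat) (u v : 'I_n -> 'rV[R]_d) :
  mean_vec (fun i => u i - v i) = mean_vec u - mean_vec v.
Proof. by rewrite /mean_vec sumrB scalerBr. Qed.

Lemma mean_vec_cst (R : realType) (d n : nat) (v : 'rV[R]_d) : (0 < n)%N ->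
  mean_vec (fun _ : 'I_n => v) = v.
Proof.
move=> n0; rewrite /mean_vec sumr_const card_ord -[v *+ n]scaler_nat scalerA.
by rewrite mulVf ?scale1r// pnatr_eq0 -lt0n.
Qed.

(** * Bounds on the workers' increments in a frozen state *)

Section worker_estimates.
Context (R : realType) (d n m : nat).
Hypotheses (n_gt0 : (0 < n)%N) (m_gt0 : (0 < m)%N).
Variables (Fij : 'I_n -> 'I_m -> 'rV[R]_d -> 'rV[R]_d) (xs : 'rV[R]_d).
Let F := mean_op Fij.
Let Fi := worker_op Fij.
Variables (x : 'rV[R]_d) (w h : 'I_n -> 'rV[R]_d).

(** This is [vr_Delta] with the state frozen and the random index made an explicit argument. *)
Definition increment i e : 'rV[R]_d :=
  Fij i e x - Fij i e (w i) + Fi i (w i) - h i.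

Let inc_mean i : mean_vec (increment i) = Fi i x - h i.
Proof.
rewrite mean_vecB mean_vecD mean_vecB !mean_vec_cst//.
by rewrite -/(worker_op Fij i x) -/(worker_op Fij i (w i)) subrK.
Qed.

Lemma increment_mean :
  mean_vec h + mean_vec (fun i => mean_vec (increment i)) = F x.
Proof.
rewrite -mean_vecD /F /mean_op; congr mean_vec; apply/funext => i.
by rewrite inc_mean addrC subrK.
Qed.

(** The share of one worker in a componentwise sum: at [w i] it enters the second part of
    [sigma ^+ 2], at [x] the bound by [ltilde]. *)
Definition comp_gap (v : 'rV[R]_d) i : R :=
  m%:R^-1 * \sum_e enorm (Fij i e v - Fij i e xs) ^+ 2.

Let spread i : R :=
  m%:R^-1 * \sum_e enorm (increment i e - mean_vec (increment i)) ^+ 2.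

(** [Fi i (w i)] and [h i] do not depend on the index and cancel under centring. The variance is
    then at most the second moment, where [Fij i e xs] is inserted. *)
Let spread_le i : spread i <= 2 * comp_gap x i + 2 * comp_gap (w i) i.
Proof.
pose u e := Fij i e x - Fij i e (w i).
have -> : spread i = m%:R^-1 * \sum_e enorm (u e - mean_vec u) ^+ 2.
  congr (_ * _); apply: eq_bigr => e _; congr (enorm _ ^+ 2).
  rewrite /increment !mean_vecB mean_vecD mean_vecB !mean_vec_cst//.
  by rewrite /u; apply/rowP => c; rewrite !mxE; ring.
apply: (@le_trans _ _ (m%:R^-1 * \sum_e enorm (u e) ^+ 2)).
  have := mean_sqr_enorm u 0 1 m_gt0.
  under eq_bigr do rewrite add0r scale1r.
  by move=> ->; rewrite expr1n mul1r lerDr sqr_ge0.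
rewrite /comp_gap ![2 * (_ * _)]mulrCA -mulrDr ler_wpM2l ?invr_ge0//.
rewrite !big_distrr/= -big_split/=; apply: ler_sum => e _.
exact: sqr_enormB_le.
Qed.

Let mean_sqr_increment i (b : 'rV[R]_d) (a : R) :
  m%:R^-1 * (\sum_e enorm (b + a *: increment i e) ^+ 2) =
  enorm (b + a *: (Fi i x - h i)) ^+ 2 + a ^+ 2 * spread i.
Proof. by rewrite mean_sqr_enorm// -/(spread i) inc_mean. Qed.

Let mean_sqr_increment1 i :
  m%:R^-1 * (\sum_e enorm (increment i e) ^+ 2) =
  enorm (Fi i x - h i) ^+ 2 + spread i.
Proof.
have := mean_sqr_increment i 0 1; rewrite expr1n mul1r add0r scale1r => <-.
by congr (_ * _); apply: eq_bigr => e _; rewrite add0r scale1r.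
Qed.

(** Averaging over the index leaves the mean increment [Fi i x - h i], to which [sqr_enorm_step_le]
    applies and in which [h i] cancels, plus [spread i] with factor [alpha ^+ 2 * (1 + omega)], at
    most [alpha]. *)
Lemma shift_update_le i (alpha omega : R) : 0 <= alpha -> 0 <= omega ->
  alpha * (1 + omega) <= 1 ->
  m%:R^-1 * (\sum_e (enorm (h i - Fi i xs + alpha *: increment i e) ^+ 2
     + alpha ^+ 2 * omega * enorm (increment i e) ^+ 2)) <=
  (1 - alpha) * enorm (h i - Fi i xs) ^+ 2
  + alpha * enorm (Fi i x - Fi i xs) ^+ 2
  + alpha * (2 * comp_gap x i + 2 * comp_gap (w i) i).
Proof.
move=> a0 o0 ao.
have ao' : alpha ^+ 2 * (1 + omega) <= alpha.
  by rewrite expr2 -mulrA ler_piMr.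
rewrite big_split/= -big_distrr/= mulrDr mean_sqr_increment.
rewrite [m%:R^-1 * (_ * \sum_e _)]mulrCA mean_sqr_increment1.
have := sqr_enorm_step_le (h i - Fi i xs) (Fi i x - h i) ao'.
rewrite (_ : h i - Fi i xs + (Fi i x - h i) = Fi i x - Fi i xs); last first.
  by rewrite addrC addrA subrK.
have s0 : 0 <= spread i.
  by rewrite mulr_ge0 ?invr_ge0// sumr_ge0// => e _; rewrite sqr_ge0.
have := ler_wpM2r s0 ao'; have := ler_wpM2l a0 (spread_le i).
set N1 := enorm (_ + alpha *: _) ^+ 2; set N2 := enorm (Fi i x - h i) ^+ 2.
nra.
Qed.

(** In the coefficient of [gap], [ell / 2] comes from the squared bias, [ltilde / n] from sampling
    the index and the [omega] term from compression. *)
Lemma estimator_sqr_le (omega gap ell lhat ltilde : R) : 0 <= omega ->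
  enorm (F x - F xs) ^+ 2 <= ell * gap ->
  n%:R^-1 * (\sum_i enorm (Fi i x - Fi i xs) ^+ 2) <= lhat * gap ->
  n%:R^-1 * (\sum_i comp_gap x i) <= ltilde * gap ->
  enorm (mean_vec h + mean_vec (fun i => mean_vec (increment i)) - F xs) ^+ 2
    + n%:R^-1 ^+ 2 * (\sum_i (m%:R^-1 * \sum_e
       (enorm (increment i e - mean_vec (increment i)) ^+ 2
       + omega * enorm (increment i e) ^+ 2))) <=
  2 * (ell / 2 + ltilde / n%:R + omega * (lhat + ltilde) / n%:R) * gap
  + 2 * (omega + 1) / n%:R *
    (n%:R^-1 * (\sum_i enorm (h i - Fi i xs) ^+ 2)
     + n%:R^-1 * (\sum_i comp_gap (w i) i)).
Proof.
move=> o0 hF hhat htil; rewrite increment_mean.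
set al := n%:R^-1 * (\sum_i enorm (Fi i x - Fi i xs) ^+ 2) in hhat *.
set be := n%:R^-1 * (\sum_i comp_gap x i) in htil *.
set eta := n%:R^-1 * \sum_i enorm (h i - _) ^+ 2.
set th := n%:R^-1 * (\sum_i comp_gap (w i) i).
have ni : 0 <= n%:R^-1 :> R by rewrite invr_ge0.
have eta0 : 0 <= eta by rewrite mulr_ge0// sumr_ge0// => i _; rewrite sqr_ge0.
have worker i : m%:R^-1 * (\sum_e
     (enorm (increment i e - mean_vec (increment i)) ^+ 2
     + omega * enorm (increment i e) ^+ 2)) <=
   (2 * comp_gap x i + 2 * comp_gap (w i) i) + omega *
    (2 * enorm (Fi i x - Fi i xs) ^+ 2 + 2 * enorm (h i - Fi i xs) ^+ 2
     + (2 * comp_gap x i + 2 * comp_gap (w i) i)).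
  rewrite big_split/= -big_distrr/= mulrDr -/(spread i) lerD ?spread_le//.
  rewrite mulrCA ler_wpM2l//.
  rewrite mean_sqr_increment1.
  by rewrite lerD ?spread_le// sqr_enormB_le.
have sum_le : n%:R^-1 * (\sum_i (m%:R^-1 * \sum_e
       (enorm (increment i e - mean_vec (increment i)) ^+ 2
       + omega * enorm (increment i e) ^+ 2))) <=
    (2 * be + 2 * th) + omega * (2 * al + 2 * eta + (2 * be + 2 * th)).
  apply: (le_trans (ler_wpM2l ni (ler_sum _ (fun i _ => worker i)))).
  have sums (b t a e : 'I_n -> R) : n%:R^-1 * (\sum_i (2 * b i + 2 * t i +
      omega * (2 * a i + 2 * e i + (2 * b i + 2 * t i)))) =
    2 * (n%:R^-1 * \sum_i b i) + 2 * (n%:R^-1 * \sum_i t i) +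
    omega * (2 * (n%:R^-1 * \sum_i a i) + 2 * (n%:R^-1 * \sum_i e i)
      + (2 * (n%:R^-1 * \sum_i b i) + 2 * (n%:R^-1 * \sum_i t i))).
    by rewrite big_split/= -big_distrr/= !big_split/= -!big_distrr/=; ring.
  by rewrite sums.
rewrite [n%:R^-1 ^+ 2]expr2 -[n%:R^-1 * n%:R^-1 * _]mulrA.
have B1 := ler_wpM2l ni sum_le.
(* [eta] appears with factor [2 * omega] only; it is rounded up to [2 * (omega + 1)], the factor of
   [th], so that both parts of [sigma ^+ 2] share one coefficient. *)
have : (2 * be + 2 * th) + omega * (2 * al + 2 * eta + (2 * be + 2 * th)) <=
  2 * (ltilde * gap) + omega * (2 * (lhat * gap) + 2 * (ltilde * gap))
  + 2 * (omega + 1) * (eta + th) by nra.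
move=> /(ler_wpM2l ni) B2.
apply: (le_trans (lerD hF (le_trans B1 B2))).
by rewrite le_eqVlt; apply/orP; left; apply/eqP; field; rewrite pnatr_eq0 -lt0n.
Qed.

End worker_estimates.

(** [xs] itself is a minimiser, so the choice in [argmin] never falls back on its default [0] and
    must return the only point available. *)
Lemma proj_set1 (R : realType) (d : nat) (xs x : 'rV[R]_d) :
  proj_set [set xs] x = xs.
Proof.
rewrite /proj_set /argmin.
set S := [set y | _].
have Sxs : S xs by split => // z ->.
by have [] := xgetPex 0 (ex_intro _ xs Sxs).
Qed.

Section vector_measurability.
Context (R : realType) (d : nat) (dT : measure_display) (T : measurableType dT).

Lemma measurable_fun_coord (f : T -> 'rV[R]_d) c :
  measurable_fun setT (f : T -> borel_vec R d) -> measurable_fun setT (fun t => f t 0 c).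
Proof. by move=> mf; exact: (measurableT_comp (measurable_coord c) mf). Qed.

Lemma measurable_sqr_enorm (f : T -> 'rV[R]_d) :
  (forall c, measurable_fun setT (fun t => f t 0 c)) ->
  measurable_fun setT (fun t => enorm (f t) ^+ 2).
Proof.
move=> mf; under eq_fun do rewrite sqr_enorm.
by apply: measurable_sum => c; exact: measurable_funX.
Qed.

End vector_measurability.

(** * One iteration of VR-DIANA-SGDA *)

Section iteration.
Context (R : realType) (d n m : nat) (dO dX : measure_display)
  (Omega : measurableType dO) (Xi : measurableType dX).
Hypotheses (n_gt0 : (0 < n)%N) (m_gt0 : (0 < m)%N).
Variables (P : probability Omega R) (nu : probability Xi R).
Variables (Fij : 'I_n -> 'I_m -> 'rV[R]_d -> 'rV[R]_d) (xs : 'rV[R]_d).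
Let F := mean_op Fij.
Let Fi := worker_op Fij.
Hypothesis mF : forall i j,
  measurable_fun [set: borel_vec R d] (Fij i j : borel_vec R d -> borel_vec R d).
Variables (Q : 'rV[R]_d -> Xi -> 'rV[R]_d) (omega : R).
Hypotheses (omega_ge0 : 0 <= omega) (hQ : unbiased_compressor nu Q omega).
Variables (s : vr_process R d n m Omega Xi) (p : R).
Hypothesis past_measurable : forall k A, past_gen s k A -> measurable A.
Variable k : nat.
Hypothesis fresh : fresh_randomness s P nu p k.
Hypothesis hmE : forall o, vr_hm s k o = mean_vec (fun i => vr_h s k i o).

Local Notation G := (past_gen s k).
Local Notation OG := (g_sigma_algebraType G).
Local Notation j := (vr_j s k).
Local Notation xi := (vr_xi s k).
Local Notation N := (noise_gen j xi predT).
Local Notation ON := (g_sigma_algebraType N).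
Local Notation D o := (increment Fij (vr_x s k o) (fun i => vr_w s k i o)
  (fun i => vr_h s k i o)).

Let mG : G `<=` measurable. Proof. exact: past_measurable. Qed.

Let mj i a : measurable (j i @^-1` [set a]).
Proof.
(* The noise of iteration [k] enters the generators of the past only from [k.+1] on. *)
apply: (past_measurable (k := k.+1)); right; exists k => //; exists i.
by constructor 1; exists a.
Qed.

Let mcoin i : measurable [set o | vr_coin s k i o].
Proof.
apply: (past_measurable (k := k.+1)); right; exists k => //; exists i.
by constructor 2.
Qed.

Let mxi i : measurable_fun setT (xi i).
Proof.
move=> _ B mB; rewrite setTI.
apply: (past_measurable (k := k.+1)); right; exists k => //; exists i.
by constructor 3; exists B.
Qed.

Let frJ := fresh.1.

Let mx : measurable_fun setT (vr_x s k : OG -> borel_vec R d).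
Proof.
move=> _ B mB; rewrite setTI; apply: sub_sigma_algebra; left.
by exists k => //; exists B => //; constructor 1.
Qed.

Let mhm : measurable_fun setT (vr_hm s k : OG -> borel_vec R d).
Proof.
move=> _ B mB; rewrite setTI; apply: sub_sigma_algebra; left.
by exists k => //; exists B => //; constructor 2.
Qed.

Let mh i : measurable_fun setT (vr_h s k i : OG -> borel_vec R d).
Proof.
move=> _ B mB; rewrite setTI; apply: sub_sigma_algebra; left.
by exists k => //; exists B => //; constructor 3; exists i; left.
Qed.

Let mw i : measurable_fun setT (vr_w s k i : OG -> borel_vec R d).
Proof.
move=> _ B mB; rewrite setTI; apply: sub_sigma_algebra; left.
by exists k => //; exists B => //; constructor 3; exists i; right.
Qed.

Let mFi i c :
  measurable_fun [set: borel_vec R d] (fun v : borel_vec R d => Fi i v 0 c).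
Proof.
rewrite (_ : (fun _ => _) = (fun v => m%:R^-1 * \sum_e Fij i e v 0 c)); last first.
  by apply/funext => v; exact: mean_vecE.
apply: measurable_funM => //; apply: measurable_sum => e.
exact: measurable_fun_coord.
Qed.

Let mcomp_gap i :
  measurable_fun [set: borel_vec R d] (fun v : borel_vec R d => comp_gap Fij xs v i).
Proof.
apply: measurable_funM => //; apply: measurable_sum => e.
apply: measurable_sqr_enorm => c.
rewrite (_ : (fun _ => _) = (fun v => Fij i e v 0 c - Fij i e xs 0 c)); last first.
  by apply/funext => v; rewrite !mxE.
by apply: measurable_funB => //; exact: measurable_fun_coord.
Qed.

Let mD i e : measurable_fun setT ((fun o => D o i e) : OG -> borel_vec R d).
Proof.
apply: measurable_vec => c.
rewrite (_ : (fun _ => _) = (fun o => Fij i e (vr_x s k o) 0 c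
   - Fij i e (vr_w s k i o) 0 c + Fi i (vr_w s k i o) 0 c - vr_h s k i o 0 c)); last first.
  apply/funext => o; rewrite /increment 3!mxE.
  by rewrite [(- Fij _ _ _) 0 c]mxE [(- vr_h _ _ _ _) 0 c]mxE.
apply: measurable_funB; last exact: measurable_fun_coord.
apply: measurable_funD; first apply: measurable_funB.
- exact: (measurable_fun_coord c (measurableT_comp (mF i e) mx)).
- exact: (measurable_fun_coord c (measurableT_comp (mF i e) (mw i))).
- exact: (measurableT_comp (mFi i c) (mw i)).
Qed.

Let mQD i c : measurable_fun [set: OG * ON]
  (fun z => Q (D z.1 i (j i z.2)) (xi i z.2) 0 c).
Proof.
have [mQ _ _] := hQ.
pose psi e (z : OG * Xi) : R := Q (D z.1 i e) z.2 0 c.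
apply: (measurable_noise_fun (r := predT) (i := i) (psi := psi)) => // e.
have mp : measurable_fun [set: OG * Xi]
    (fun z : OG * Xi => ((D z.1 i e, z.2) : borel_vec R d * Xi)).
  apply: measurable_fun_pair => //.
  exact: (measurableT_comp (mD i e) measurable_fst).
exact: (measurableT_comp (measurable_coord c) (measurableT_comp mQ mp)).
Qed.

Let mest c : measurable_fun [set: OG * ON] (fun z =>
  (vr_hm s k z.1 + mean_vec (fun i => Q (D z.1 i (j i z.2)) (xi i z.2))) 0 c).
Proof.
rewrite (_ : (fun _ => _) = (fun z : OG * ON => vr_hm s k z.1 0 c +
   n%:R^-1 * \sum_i Q (D z.1 i (j i z.2)) (xi i z.2) 0 c)); last first.
  by apply/funext => z; rewrite mxE mean_vecE.
apply: measurable_funD.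
  exact: (measurableT_comp (measurable_fun_coord c mhm) measurable_fst).
by apply: measurable_funM => //; apply: measurable_sum.
Qed.

Let N_measurable : N `<=` measurable.
Proof. exact: noise_gen_measurable. Qed.

Let N_setI : setI_closed N.
Proof. exact: noise_gen_setI. Qed.

Let N_indep A B : <<s G >> A -> N B -> P (A `&` B) = (P A * P B)%E.
Proof. exact: (past_noise_indep mj mxi mG frJ). Qed.

Lemma estimator_unbiased :
  is_cexp_vec P (past s k) (vr_g Fij Q s k) (fun o => F (vr_x s k o)).
Proof.
move=> c.
pose f o o' := (vr_hm s k o + mean_vec (fun i => Q (D o i (j i o')) (xi i o'))) 0 c.
apply: (is_cexp_freeze mG N_measurable N_setI N_indep (f := f)).
- exact: mest.
- by move=> o; exact: (round_mean m_gt0 mj mxi mG frJ hQ (D o) (vr_hm s k o) c).1.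
- move=> o; rewrite (round_mean m_gt0 mj mxi mG frJ hQ (D o) (vr_hm s k o) c).2.
  by rewrite hmE increment_mean.
Qed.

Lemma estimator_cexp_le (ell lhat ltilde : R) (gap : Omega -> R) :
  (forall o, enorm (F (vr_x s k o) - F xs) ^+ 2 <= ell * gap o) ->
  (forall o, n%:R^-1 * (\sum_i enorm (Fi i (vr_x s k o) - Fi i xs) ^+ 2)
     <= lhat * gap o) ->
  (forall o, n%:R^-1 * (\sum_i comp_gap Fij xs (vr_x s k o) i)
     <= ltilde * gap o) ->
  cexp_nneg_le P (past s k) (fun o => enorm (vr_g Fij Q s k o - F xs) ^+ 2)
    (fun o =>
      2 * (ell / 2 + ltilde / n%:R + omega * (lhat + ltilde) / n%:R) * gap o
      + 2 * (omega + 1) / n%:R *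
       (n%:R^-1 * (\sum_i enorm (vr_h s k i o - Fi i xs) ^+ 2)
        + n%:R^-1 * (\sum_i comp_gap Fij xs (vr_w s k i o) i))).
Proof.
move=> hF hhat htil.
pose f o o' := enorm (vr_hm s k o
  + mean_vec (fun i => Q (D o i (j i o')) (xi i o')) - F xs) ^+ 2.
apply: (cexp_nneg_le_freeze mG N_measurable N_setI N_indep (f := f)).
- apply: measurable_sqr_enorm => c.
  rewrite (_ : (fun _ => _) = (fun z : OG * ON => (vr_hm s k z.1
    + mean_vec (fun i => Q (D z.1 i (j i z.2)) (xi i z.2))) 0 c - F xs 0 c)).
    by apply: measurable_funB => //; exact: mest.
  by apply/funext => z; rewrite mxE [(- F xs) 0 c]mxE.
- by move=> o o'; rewrite sqr_ge0.
- move=> o; apply: (le_trans (round_sqr_le m_gt0 mj mxi mG frJ hQ _ _ _)).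
  rewrite lee_fin hmE; exact: estimator_sqr_le.
Qed.

Lemma shift_cexp_le i (alpha : R) : 0 <= alpha -> alpha * (1 + omega) <= 1 ->
  cexp_nneg_le P (past s k)
    (fun o =>
      enorm (vr_h s k i o + alpha *: vr_QDelta Fij Q s k i o - Fi i xs) ^+ 2)
    (fun o => (1 - alpha) * enorm (vr_h s k i o - Fi i xs) ^+ 2
      + alpha * enorm (Fi i (vr_x s k o) - Fi i xs) ^+ 2
      + alpha * (2 * comp_gap Fij xs (vr_x s k o) i
        + 2 * comp_gap Fij xs (vr_w s k i o) i)).
Proof.
move=> a0 ao.
pose f o o' := enorm (vr_h s k i o - Fi i xs
  + alpha *: Q (D o i (j i o')) (xi i o')) ^+ 2.
rewrite (_ : (fun o => enorm (_ + _ - _) ^+ 2) = (fun o => f o o)); last first.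
  by apply/funext => o; rewrite /f addrAC.
apply: (cexp_nneg_le_freeze mG N_measurable N_setI N_indep (f := f)).
- apply: measurable_sqr_enorm => c.
  rewrite (_ : (fun _ => _) = (fun z : OG * ON => vr_h s k i z.1 0 c - Fi i xs 0 c
    + alpha * Q (D z.1 i (j i z.2)) (xi i z.2) 0 c)).
    apply: measurable_funD.
      apply: measurable_funB => //.
      exact: (measurableT_comp (measurable_fun_coord c (mh i)) measurable_fst).
    by apply: measurable_funM => //; exact: mQD.
  by apply/funext => z; rewrite !mxE.
- by move=> o o'; rewrite sqr_ge0.
- move=> o; apply: (le_trans (worker_sqr_le m_gt0 mj mxi mG frJ hQ _ _ _ _)).
  by rewrite lee_fin; exact: shift_update_le.
Qed.

(** Here the fresh noise is the coin of worker [i] alone, so the freezing argument is run with the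
    sigma-algebra of that single event. *)
Lemma refresh_cexp_le i :
  cexp_nneg_le P (past s k)
    (fun o =>
      comp_gap Fij xs (if vr_coin s k i o then vr_x s k o else vr_w s k i o) i)
    (fun o => p * comp_gap Fij xs (vr_x s k o) i
      + (1 - p) * comp_gap Fij xs (vr_w s k i o) i).
Proof.
pose C := [set o | vr_coin s k i o].
(* One event is already a pi-system. *)
pose H : set (set Omega) := [set C].
have frC := fresh.2.
have PC : P C = p%:E.
  by have := frC setT i (@g_sigma_algebraT _ G); rewrite setTI probability_setT mul1e.
have HI : setI_closed H by move=> _ _ -> ->; rewrite setIid.
have mH : H `<=` measurable by move=> _ ->; exact: mcoin.
have HP A B : <<s G >> A -> H B -> P (A `&` B) = (P A * P B)%E.
  by move=> GA ->; rewrite PC frC.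
pose gap v := comp_gap Fij xs v i.
pose f o o' := gap (vr_w s k i o) + (gap (vr_x s k o) - gap (vr_w s k i o)) * \1_C o'.
have fE o o' : f o o' = gap (if vr_coin s k i o' then vr_x s k o else vr_w s k i o).
  rewrite /f indicE; have [co|co] := boolP (vr_coin s k i o').
    by rewrite mem_set// mulr1 addrC subrK.
  by rewrite memNset ?mulr0 ?addr0//; apply/negP.
rewrite (_ : (fun o => comp_gap _ _ _ _) = (fun o => f o o)); last first.
  by apply/funext => o; rewrite fE.
have mgap (v : OG -> borel_vec R d) : measurable_fun setT v ->
    measurable_fun setT (fun o => gap (v o)).
  by move=> mv; exact: (measurableT_comp (mcomp_gap i) mv).
apply: (cexp_nneg_le_freeze mG mH HI HP (f := f)).
- apply: measurable_funD.
    exact: (measurableT_comp (mgap _ (mw i)) measurable_fst).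
  apply: measurable_funM.
    apply: measurable_funB.
      exact: (measurableT_comp (mgap _ mx) measurable_fst).
    exact: (measurableT_comp (mgap _ (mw i)) measurable_fst).
  have mC : measurable_fun [set: g_sigma_algebraType H] (\1_C : _ -> R).
    by apply: measurable_indic; apply: sub_sigma_algebra.
  exact: (measurableT_comp mC measurable_snd).
- move=> o o'; rewrite fE mulr_ge0 ?invr_ge0// sumr_ge0// => e _.
  by rewrite sqr_ge0.
- move=> o.
  have iC : P.-integrable setT (EFin \o (\1_C : Omega -> R)).
    by apply: integrable_indic => //; exact: mcoin.
  have eC : (\int[P]_o' (\1_C o')%:E = p%:E)%E.
    by rewrite integral_indic ?setIT ?PC//; exact: mcoin.
  rewrite (integral_affine _ _ iC eC).2 lee_fin /gap.
  by rewrite le_eqVlt; apply/orP; left; apply/eqP; ring.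
Qed.

End iteration.

(** * Assembly of the key parametric assumption *)

Theorem proposition5p6 (R : realType) (d n m : nat)
  (hn : (0 < n)%N) (hm : (0 < m)%N)
  (Fij : 'I_n -> 'I_m -> 'rV[R]_d -> 'rV[R]_d)
  (Reg : 'rV[R]_d -> \bar R) (xs : 'rV[R]_d)
  (F := mean_op Fij) (Fi := worker_op Fij) (Xs := vi_solutions F Reg)
  (hFij : forall i j,
     measurable_fun [set: borel_vec R d] (Fij i j : borel_vec R d -> borel_vec R d))
  (hproper : proper_ereal Reg) (hlsc : lower_semicontinuous Reg)
  (hconvex : convex_ereal Reg)
  (hXs : Xs = [set xs])
  (ell lhat ltilde : R) (hell : 0 < ell) (hlhat : 0 < lhat) (hltilde : 0 < ltilde)
  (hF : star_cocoercive ell F Xs)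
  (hFhat : forall x, let x_ := proj_set Xs x in
     n%:R^-1 * (\sum_(i < n) enorm (Fi i x - Fi i x_) ^+ 2)
     <= lhat * dotv (F x - F x_) (x - x_))
  (hFtilde : forall x, let x_ := proj_set Xs x in
     (n * m)%:R^-1 * (\sum_(i < n) \sum_(j < m) enorm (Fij i j x - Fij i j x_) ^+ 2)
     <= ltilde * dotv (F x - F x_) (x - x_))
  (dX : measure_display) (Xi : measurableType dX) (nu : probability Xi R)
  (Q : 'rV[R]_d -> Xi -> 'rV[R]_d) (omega : R) (homega : 0 <= omega)
  (hQ : unbiased_compressor nu Q omega)
  (p gamma alpha : R) (hp0 : 0 < p) (hp1 : p <= 1) (hgamma : 0 < gamma)
  (halpha0 : 0 < alpha) (halpha : alpha <= Num.min (p / 3) (1 / (1 + omega)))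
  (x0 : 'rV[R]_d) (h0 w0 : 'I_n -> 'rV[R]_d)
  (dO : measure_display) (Omega : measurableType dO) (P : probability Omega R)
  (s : vr_process R d n m Omega Xi)
  (hs : vr_diana_sgda Fij Q s P nu Reg p gamma alpha x0 h0 w0)
  (sigma : nat -> Omega -> R) (hsigma0 : forall k o, 0 <= sigma k o)
  (hsigma : forall k o, sigma k o ^+ 2 =
     n%:R^-1 * (\sum_(i < n) enorm (vr_h s k i o - Fi i xs) ^+ 2)
     + (n * m)%:R^-1 *
       (\sum_(i < n) \sum_(j < m) enorm (Fij i j (vr_w s k i o) - Fij i j xs) ^+ 2)) :
  key_parametric_assumption P (past s) F Xs (vr_x s) (vr_g Fij Q s)
    (ell / 2 + ltilde / n%:R + omega * (lhat + ltilde) / n%:R)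
    (2 * (omega + 1) / n%:R)
    (p * ltilde / 2 + alpha * (ltilde + lhat))
    0 0 alpha sigma.
Proof.
have [past_meas fr init step] := hs.
have projE x : proj_set Xs x = xs by rewrite hXs proj_set1.
have ni : 0 <= n%:R^-1 :> R by rewrite invr_ge0.
(* Master and workers add the same compressed vectors, so the average is preserved at every
   iteration. *)
have hm_mean k o : vr_hm s k o = mean_vec (fun i => vr_h s k i o).
  elim: k => [|k IH].
    have [_ -> h0E _] := init o; congr mean_vec.
    by apply/funext => i; rewrite h0E.
  have [_ -> hE _] := step k o.
  rewrite (_ : (fun i => vr_h s k.+1 i o) =
    (fun i => vr_h s k i o + alpha *: vr_QDelta Fij Q s k i o)); last first.
    by apply/funext => i; rewrite hE.
  rewrite mean_vecD -IH; congr (_ + _).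
  by rewrite /mean_vec -scaler_sumr !scalerA mulrC.
have [alpha_p alpha_o] : alpha <= p / 3 /\ alpha * (1 + omega) <= 1.
  move: halpha; rewrite le_min => /andP[-> h]; split => //.
  by rewrite -ler_pdivlMr// ltr_wpDr.
have gapsum v : (n * m)%:R^-1 * (\sum_(i < n) \sum_(e < m)
    enorm (Fij i e (v i) - Fij i e xs) ^+ 2) =
    n%:R^-1 * (\sum_i comp_gap Fij xs (v i) i).
  by rewrite /comp_gap -big_distrr/= natrM invfM mulrA.
pose gap x := dotv (F x - F xs) (x - xs).
have hat x : n%:R^-1 * (\sum_i enorm (Fi i x - Fi i xs) ^+ 2) <= lhat * gap x.
  by have := hFhat x; rewrite projE.
have til x : n%:R^-1 * (\sum_i comp_gap Fij xs x i) <= ltilde * gap x.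
  by have := hFtilde x; rewrite projE -gapsum.
have coc x : enorm (F x - F xs) ^+ 2 <= ell * gap x.
  by have := hF x; rewrite /= projE.
split.
- have l0 := ltW hell; have lh0 := ltW hlhat; have lt0 := ltW hltilde.
  have p0 := ltW hp0; have a0 := ltW halpha0.
  by split; rewrite ?(addr_ge0, mulr_ge0, divr_ge0).
(* [alpha <= p / 3] and [p <= 1] give [alpha <= 1]. *)
- by rewrite halpha0/=; lra.
- exact: hsigma0.
move=> k; split.
- exact: (estimator_unbiased hm hFij hQ past_meas (fr k) (hm_mean k)).
- under eq_fun do rewrite projE.
  under [X in cexp_nneg_le _ _ _ X]eq_fun do rewrite projE hsigma gapsum addr0.
  apply: (estimator_cexp_le hn hm hFij homega hQ past_meas (fr k) (hm_mean k)
    (gap := fun o => gap (vr_x s k o))) => o //.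
- under eq_fun do rewrite hsigma gapsum.
  under [X in cexp_nneg_le _ _ _ X]eq_fun do rewrite projE hsigma gapsum addr0.
  have G := past_meas k.
  have shift i := shift_cexp_le hm xs hFij homega hQ past_meas (fr k) i
     (ltW halpha0) alpha_o.
  have refresh i := refresh_cexp_le xs hFij past_meas (fr k) i.
  (* By linearity the shift part and the refresh part of [sigma ^+ 2] are bounded separately, each
     from its own source of randomness, and then averaged. *)
  have worker_step := cexp_nneg_leZ G ni (cexp_nneg_le_sum G (index_enum 'I_n)
    (fun i => cexp_nneg_leD G (shift i) (refresh i))).
  rewrite (_ : (fun o => _ + _) = (fun o => n%:R^-1 * \sum_i
     (enorm (vr_h s k i o + alpha *: vr_QDelta Fij Q s k i o - Fi i xs) ^+ 2 +
      comp_gap Fij xs (if vr_coin s k i o then vr_x s k o else vr_w s k i o) i)));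
    last first.
    apply/funext => o; rewrite -mulrDr -big_split/=; congr (_ * _).
    by apply: eq_bigr => i _; have [_ _ -> ->] := step k o.
  apply: cexp_nneg_le_trans worker_step => o.
  have sums (b t a e : 'I_n -> R) : n%:R^-1 * (\sum_i ((1 - alpha) * e i + alpha * a i
      + alpha * (2 * b i + 2 * t i) + (p * b i + (1 - p) * t i))) =
    (1 - alpha) * (n%:R^-1 * \sum_i e i) + alpha * (n%:R^-1 * \sum_i a i)
    + alpha * (2 * (n%:R^-1 * \sum_i b i) + 2 * (n%:R^-1 * \sum_i t i))
    + (p * (n%:R^-1 * \sum_i b i) + (1 - p) * (n%:R^-1 * \sum_i t i)).
    by rewrite !big_split/= -!big_distrr/= big_split/= -!big_distrr/=; ring.
  rewrite sums -/(gap (vr_x s k o)).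
  set eta := n%:R^-1 * \sum_i enorm (vr_h s k i o - _) ^+ 2.
  set th := n%:R^-1 * \sum_i comp_gap Fij xs (vr_w s k i o) i.
  have th0 : 0 <= th.
    rewrite mulr_ge0// sumr_ge0// => i _.
    by rewrite mulr_ge0 ?invr_ge0// sumr_ge0// => e _; rewrite sqr_ge0.
  (* The estimate produces [alpha * lhat * g], while [2 * C] offers twice that amount; the slack is
     nonnegative because [lhat * g] dominates this average. *)
  have al0 : 0 <= n%:R^-1 * \sum_i enorm (Fi i (vr_x s k o) - Fi i xs) ^+ 2.
    by rewrite mulr_ge0// sumr_ge0// => i _; rewrite sqr_ge0.
  move: al0 (hat (vr_x s k o)) (til (vr_x s k o)) alpha_p halpha0 hp0.
  set g := gap _; set al := n%:R^-1 * _; set be := n%:R^-1 * _.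
  move=> al0 hal hbe ap a0 p0.
  have := ler_wpM2l (ltW a0) hal; have := ler_wpM2l (ltW a0) hbe.
  have := ler_wpM2l (ltW p0) hbe; have := ler_wpM2l (ltW a0) al0.
  (* The total coefficient of [th] is [2 * alpha + (1 - p)], and [3 * alpha <= p] brings it below
     [1 - alpha]. *)
  have : 0 <= (p - 3 * alpha) * th by rewrite mulr_ge0//; lra.
  lra.
Qed.
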